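(* Let $\alpha\in(0,1)$ with $\alpha\ne1/n$ for all $n\in\mathbb N$ and $0<\beta<\alpha$. Let $\mathbf X\in\mathscr C^\alpha$ be an $\alpha$-rough path and assume that there are smooth rough paths $\mathbf X_\eta$, $\eta\in(0,1]$ (i.e. canonical lifts of smooth paths), with $\rho_\alpha(\mathbf X_\eta,\mathbf X)\to0$ as $\eta\to0$. Then for every $\mathbf Z\in\mathscr D^{\alpha,\beta}_{\mathbf X}$ there are smooth $\mathbf Z_\eta\in\mathscr D^{\alpha,\beta}_{\mathbf X_\eta}$ (all coefficient functions $t\mapsto\langle h,(\mathbf Z_\eta)_t\rangle$ are smooth) such that $$|||\mathbf Z;\mathbf Z_\eta|||_\beta\to0\quad\text{as }\eta\to0 .$$
   Context: Forests. $A$ is a fixed finite nonempty set. $\mathcal F$ is the set of forests (commutative monomials of non-planar rooted trees with nodes labelled by $A$), including the empty forest $\mathbf 1$; $\mathcal H$ is the real vector space with basis $\mathcal F$, i.e. the polynomial algebra on trees. $|h|$ is the number of nodes of $h\in\mathcal F$; $\mathcal F_{(n)}=\{h\in\mathcal F:|h|\le n\}$, $\mathcal F^+_{(n)}=\mathcal F_{(n)}\setminus\{\mathbf 1\}$. For $a\in A$, $[h]_a$ is the tree obtained by grafting the trees of $h$ on a new root labelled $a$. The coproduct $\Delta:\mathcal H\to\mathcal H\otimes\mathcal H$ is the algebra morphism with $\Delta[h]_a=(\mathrm{id}\otimes[\cdot]_a)\Delta h+[h]_a\otimes\mathbf 1$. On $\mathcal H^*$, $\langle\phi\star\psi,h\rangle=\langle\phi\otimes\psi,\Delta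 h\rangle$. A forest $h$ is identified with the functional $h'\mapsto\delta_{h,h'}$, so $\bar h\star h$ is a finite linear combination of forests. Rough paths. $T>0$ is fixed; $N=\lfloor1/\alpha\rfloor$. An $\alpha$-branched rough path is a family $\mathbf X=(\mathbf X_{s,t})_{s,t\in[0,T]}$ of characters (unital multiplicative linear functionals) of $\mathcal H$ with $\mathbf X_{s,u}\star\mathbf X_{u,t}=\mathbf X_{s,t}$ and $\sup_{s\ne t}|\langle\mathbf X_{s,t},h\rangle|/|t-s|^{\alpha|h|}<\infty$ for all $h\in\mathcal F$. Write $\mathbf X^h_{s,t}=\langle\mathbf X_{s,t},h\rangle$ and $\|F\|_\gamma=\sup_{s\neq t}|F_{s,t}|/|t-s|^\gamma$. $\mathscr C^\alpha$ is the set of all of them, with the metric $\rho_\alpha(\mathbf X,\tilde{\mathbf X})=\max_{h\in\mathcal F^+_{(N)}}\|\mathbf X^h-\tilde{\mathbf X}^h\|_{|h|\alpha}$. The canonical lift of a smooth path $x:[0,T]\to\mathbb R^A$ is the family of characters given recursively by $\mathbf X^{[h]_a}_{s,t}=\int_s^t\mathbf X^h_{s,r}\,dx^a_r$. Controlled paths. For a path $\mathbf Z:[0,T]\to\mathrm{span}\,\mathcal F_{(N-1)}$ and $h\in\mathcal F_{(N-1)}$ put $R^h_{s,t}=\langle h,\mathbf Z_t\rangle-\langle\mathbf X_{s,t}\star h,\mathbf Z_s\rangle$, and for $0<\gamma\le\alpha$ put $|||\mathbf Z|||_\gamma=\sum_{h\in\mathcal F_{(N-1)}}(|\langle h,\mathbf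 Z_0\rangle|+\|R^h\|_{(N-|h|)\gamma})$ (always with $N=\lfloor 1/\alpha\rfloor$). $\mathscr D^\alpha_{\mathbf X}$ is the space of $\mathbf Z$ with $|||\mathbf Z|||_\alpha<\infty$, and $\mathscr D^{\alpha,\beta}_{\mathbf X}$ is the closure of $\mathscr D^\alpha_{\mathbf X}$ under $|||\cdot|||_\beta$ (inside the paths with $|||\mathbf Z|||_\beta<\infty$). For $\mathbf Z,\tilde{\mathbf Z}$ controlled by $\mathbf X,\tilde{\mathbf X}$ with remainders $R^h,\tilde R^h$ (each with respect to its own rough path), $|||\mathbf Z;\tilde{\mathbf Z}|||_\gamma=\sum_{h\in\mathcal F_{(N-1)}}(|\langle h,\mathbf Z_0-\tilde{\mathbf Z}_0\rangle|+\|R^h-\tilde R^h\|_{(N-|h|)\gamma})$. *)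

(* Defs.v *)
From HB Require Import structures.
From mathcomp Require Import all_boot all_order all_algebra finmap multiset.
From mathcomp Require Import all_classical all_reals all_analysis.

Set Implicit Arguments.
Unset Strict Implicit.
Unset Printing Implicit Defensive.

Import Order.TTheory GRing.Theory Num.Theory.
Import numFieldNormedType.Exports.

Local Open Scope classical_set_scope.
Local Open Scope ring_scope.

(* A non-planar tree is represented by the unique planar tree of its class
   in which the children of every node are sorted; a forest is a finite
   multiset of such trees. *)
Section Forests.
Variable A : finType.

Inductive ptree := Node of A & seq ptree.

Lemma ptree_all_ind (P : ptree -> Prop) :
  (forall a ts, foldr (fun t Q => P t /\ Q) True ts -> P (Node a ts)) ->
  forall t, P t.
Proof.
move=> IH; fix loop 1; case=> a ts; apply: IH.
by elim: ts => [|t ts IHts]; split; [exact: loop|exact: IHts].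
Qed.

Fixpoint pcode (t : ptree) : GenTree.tree A :=
  let: Node a ts := t in GenTree.Node 0 (GenTree.Leaf a :: map pcode ts).

Fixpoint pdecode (g : GenTree.tree A) : option ptree :=
  if g is GenTree.Node _ (GenTree.Leaf a :: gs)
  then Some (Node a (pmap pdecode gs)) else None.

Lemma pcodeK : pcancel pcode pdecode.
Proof.
elim/ptree_all_ind => a ts H /=; congr (Some (Node a _)).
by elim: ts H => //= t ts IH [-> /IH ->].
Qed.

HB.instance Definition _ := Countable.copy ptree (pcan_type pcodeK).

Definition ple (t u : ptree) : bool := (choice.pickle t <= choice.pickle u)%N.

Lemma ple_total : total ple.
Proof. by move=> t u; exact: leq_total. Qed.

Lemma ple_trans : transitive ple.
Proof. by move=> t u v; exact: leq_trans. Qed.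

Lemma ple_anti : antisymmetric ple.
Proof.
by move=> t u; rewrite /ple -eqn_leq => /eqP /(pcan_inj choice.pickleK).
Qed.

Fixpoint canon (t : ptree) : ptree :=
  let: Node a ts := t in Node a (sort ple (map canon ts)).

Lemma canonK t : canon (canon t) == canon t.
Proof.
apply/eqP; elim/ptree_all_ind: t => a ts H /=; congr Node.
have -> : map canon (sort ple (map canon ts)) = sort ple (map canon ts).
  rewrite -[RHS]map_id; apply/eq_in_map => u; rewrite mem_sort.
  elim: ts H => //= t ts IH [Ht /IH{}IH]; rewrite inE => /orP[/eqP->//|].
  exact: IH.
by apply: sorted_sort; [exact: ple_trans|exact: (sort_sorted ple_total)].
Qed.

Record tree := Tree { tval : ptree; tvalP : canon tval == tval }.
HB.instance Definition _ := [isSub for tval].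
HB.instance Definition _ := [Countable of tree by <:].

Definition forest : Type := {mset tree}%mset.
HB.instance Definition _ := Choice.on forest.

Definition mktree (t : ptree) : tree := Tree (canonK t).

(* the tree [h]_a *)
Definition graft (a : A) (h : forest) : tree :=
  mktree (Node a (map tval (enum_mset h))).

Fixpoint psize (t : ptree) : nat :=
  let: Node _ ts := t in (sumn (map psize ts)).+1.

Definition fsize (h : forest) : nat :=
  (\sum_(t <- enum_mset h) psize (tval t))%N.

Definition fone : forest := mset0.
Definition fmul (h k : forest) : forest := msetD h k.
Definition ftree (t : tree) : forest := msetn 1 t.

(* Elements of the tensor square are only needed as finite sums of pure
   tensors of forests (with multiplicity); such a sum is the list of its
   terms. *)
Definition tmul (s1 s2 : seq (forest * forest)) : seq (forest * forest) :=
  [seq (fmul p.1 q.1, fmul p.2 q.2) | p <- s1, q <- s2].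

Fixpoint pcoprod (t : ptree) : seq (forest * forest) :=
  let: Node a ts := t in
  (ftree (mktree t), fone) ::
  [seq (p.1, ftree (graft a p.2)) |
     p <- foldr (fun u => tmul (pcoprod u)) [:: (fone, fone)] ts].

Definition coprod (h : forest) : seq (forest * forest) :=
  foldr (fun u => tmul (pcoprod (tval u))) [:: (fone, fone)] (enum_mset h).

Definition Fle (n : nat) : set forest := [set h | (fsize h <= n)%N].
Definition Fle_pos (n : nat) : set forest := Fle n `\ fone.

End Forests.

Section ForestFacts.
Variable A : finType.
Implicit Types (h k : forest A) (s : seq (forest A * forest A)).

Lemma finite_Fle n : finite_set (@Fle A n).
Proof.
have [L HL] : exists L : seq (seq (ptree A)),
    forall ts, (sumn (map (@psize A) ts) <= n)%N -> ts \in L.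
  elim: n => [|n [L HL]].
    by exists [:: [::]] => -[//|[a us] ts] /=; rewrite addSn.
  exists ([::] :: [seq Node p.1 p.2 :: q |
                   p <- [seq (a, f) | a <- enum A, f <- L], q <- L]).
  case=> [|[a us] ts] /= H; first by rewrite inE eqxx.
  rewrite inE; apply/orP; right.
  move: H; rewrite addSn ltnS => H.
  apply/allpairsP; exists ((a, us), ts); split=> //=.
    apply/allpairsP; exists (a, us); split=> //=; first by rewrite mem_enum.
    exact: HL (leq_trans (leq_addr _ _) H).
  exact: HL (leq_trans (leq_addl _ _) H).
pose g (ts : seq (ptree A)) : forest A := seq_mset (map (@mktree A) ts).
apply: (@sub_finite_set _ _ (g @` [set` L])); last first.
  exact: finite_image (finite_seq L).
move=> h hn; exists (map (@tval A) (enum_mset h)).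
  by apply: HL; rewrite -map_comp sumnE big_map.
rewrite /g -map_comp -[RHS]seq_mset_id; congr seq_mset.
rewrite -[RHS]map_id; apply: eq_map => t /=; apply: val_inj => /=.
exact/eqP/tvalP.
Qed.

Lemma big_tmul (I : Type) (idx : I) (op : Monoid.com_law idx) s1 s2
    (F : forest A * forest A -> I) :
  \big[op/idx]_(p <- tmul s1 s2) F p =
  \big[op/idx]_(p <- s1) \big[op/idx]_(q <- s2)
     F (fmul p.1 q.1, fmul p.2 q.2).
Proof. by rewrite /tmul big_allpairs_dep. Qed.

Lemma eq_tmul_perm (s1 s2 : seq (forest A * forest A)) :
  (forall F : forest A * forest A -> nat,
     (\sum_(p <- s1) F p = \sum_(p <- s2) F p)%N) -> perm_eq s1 s2.
Proof.
move=> H; apply/permP => P.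
by rewrite -!sum1_count big_mkcond [RHS]big_mkcond H.
Qed.

Lemma perm_tmul s1 s1' s2 s2' : perm_eq s1 s1' -> perm_eq s2 s2' ->
  perm_eq (tmul s1 s2) (tmul s1' s2').
Proof.
move=> H1 H2; apply: eq_tmul_perm => F; rewrite !big_tmul (perm_big _ H1) /=.
by apply: eq_bigr => p _; rewrite (perm_big _ H2).
Qed.

Lemma tmulA s1 s2 s3 :
  perm_eq (tmul s1 (tmul s2 s3)) (tmul (tmul s1 s2) s3).
Proof.
apply: eq_tmul_perm => F; rewrite !big_tmul.
apply: eq_bigr => p _; rewrite big_tmul; apply: eq_bigr => q _.
by apply: eq_bigr => r _ /=; rewrite /fmul !msetDA.
Qed.

Lemma tmulC s1 s2 : perm_eq (tmul s1 s2) (tmul s2 s1).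
Proof.
apply: eq_tmul_perm => F; rewrite !big_tmul exchange_big /=.
apply: eq_bigr => p _; apply: eq_bigr => q _.
by rewrite /fmul (msetDC q.1) (msetDC q.2).
Qed.

Lemma tmul1 s : tmul [:: (fone A, fone A)] s = s.
Proof.
rewrite /tmul /= cats0 -[RHS]map_id; apply: eq_map => -[h k] /=.
by rewrite /fmul /fone !mset0D.
Qed.

Lemma foldr_tmul (I : Type) (f : I -> seq (forest A * forest A)) e ts :
  perm_eq (foldr (fun u => tmul (f u)) e ts)
    (tmul (foldr (fun u => tmul (f u)) [:: (fone A, fone A)] ts) e).
Proof.
elim: ts => [|u ts IH] /=; first by rewrite tmul1.
exact: perm_trans (perm_tmul (perm_refl _) IH) (tmulA _ _ _).
Qed.

Lemma perm_foldr_tmul (I : eqType) (f : I -> seq (forest A * forest A)) e ts us :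
  perm_eq ts us ->
  perm_eq (foldr (fun u => tmul (f u)) e ts) (foldr (fun u => tmul (f u)) e us).
Proof.
move=> tu.
apply: (@catCA_perm_ind _ (fun vs => perm_eq (foldr (fun u => tmul (f u)) e ts)
  (foldr (fun u => tmul (f u)) e vs)) _ _ _ tu) => // s1 s2 s3 H.
apply: perm_trans H _.
rewrite !foldr_cat.
apply: perm_trans (foldr_tmul _ _ _) _.
apply: perm_trans (perm_tmul (perm_refl _) (foldr_tmul _ _ _)) _.
apply: perm_trans (tmulA _ _ _) _.
apply: perm_trans (perm_tmul (tmulC _ _) (perm_refl _)) _.
rewrite perm_sym.
apply: perm_trans (foldr_tmul _ _ _) _.
apply: perm_trans (perm_tmul (perm_refl _) (foldr_tmul _ _ _)) _.
exact: tmulA.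
Qed.

Lemma tval_mktree (t : tree A) : mktree (tval t) = t.
Proof. by apply: val_inj => /=; exact/eqP/tvalP. Qed.

Lemma pcoprod_canon (t : ptree A) : perm_eq (pcoprod (canon t)) (pcoprod t).
Proof.
elim/ptree_all_ind: t => a ts H /=.
have -> : mktree (Node a (sort (@ple A) (map (@canon A) ts))) =
          mktree (Node a ts).
  by apply: val_inj; exact/eqP/(canonK (Node a ts)).
rewrite perm_cons; apply: perm_map.
apply: perm_trans (perm_foldr_tmul _ _ (permEl (perm_sort _ _))) _.
by elim: ts H => //= u ts IH [Hu /IH]; exact: perm_tmul.
Qed.

(* The three rules that define the coproduct. *)
Lemma coprod_one : coprod (fone A) = [:: (fone A, fone A)].
Proof. by rewrite /coprod /fone enum_mset0. Qed.

Lemma coprod_mul h k :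
  perm_eq (coprod (fmul h k)) (tmul (coprod h) (coprod k)).
Proof.
have hk : perm_eq (enum_mset (fmul h k)) (enum_mset h ++ enum_mset k).
  apply/eq_seq_msetP; rewrite seq_mset_id; apply/msetP => t.
  by rewrite mset_seqE count_cat !count_mem_mset /fmul msetE2.
apply: perm_trans (perm_foldr_tmul _ _ hk) _.
by rewrite foldr_cat; exact: foldr_tmul.
Qed.

Lemma coprod_graft a h :
  perm_eq (coprod (ftree (graft a h)))
    ((ftree (graft a h), fone A) ::
     [seq (p.1, ftree (graft a p.2)) | p <- coprod h]).
Proof.
rewrite /coprod {1}/ftree enum_msetn /=.
apply: perm_trans (tmulC _ _) _; rewrite tmul1.
apply: perm_trans (pcoprod_canon (Node a _)) _ => /=.
by rewrite perm_cons foldr_map.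
Qed.

Lemma graft_ex (t : tree A) : exists a h, t = graft a h.
Proof.
case: t => -[a ts] ht; exists a, (seq_mset (map (@mktree A) ts)).
apply: val_inj => /=.
have /= [/= hs] := eqP ht.
have tsE : [seq tval i | i <- map (@mktree A) ts] = map (@canon A) ts.
  by rewrite -map_comp.
congr Node; rewrite -[LHS]hs -tsE.
have -> : map (@canon A) [seq tval i | i <- enum_mset (seq_mset (map (@mktree A) ts))]
        = [seq tval i | i <- enum_mset (seq_mset (map (@mktree A) ts))].
  by rewrite -map_comp; apply: eq_map => u; exact/eqP/tvalP.
apply/(perm_sortP (@ple_total A) (@ple_trans A) (@ple_anti A)).
by apply: perm_map; rewrite perm_sym; exact: perm_eq_seq_mset.
Qed.

Lemma graft_inj a b h k : graft a h = graft b k -> a = b /\ h = k.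
Proof.
case=> -> hk; split=> //; rewrite -[h]seq_mset_id -[k]seq_mset_id.
have canon_val l : map (@canon A) (map (@tval A) (enum_mset l)) =
                   map (@tval A) (enum_mset l).
  by rewrite -map_comp; apply: eq_map => u; exact/eqP/tvalP.
apply/eq_seq_msetP/(perm_map_inj (@val_inj _ _ (tree A))).
move: hk; rewrite !canon_val.
by move=> /(perm_sortP (@ple_total A) (@ple_trans A) (@ple_anti A)).
Qed.

Lemma fsize_graft a h : fsize (ftree (graft a h)) = (fsize h).+1.
Proof.
have size_canon (t : ptree A) : psize (canon t) = psize t.
  elim/ptree_all_ind: t => b ts H /=; congr _.+1.
  rewrite (perm_sumn (perm_map _ (permEl (perm_sort _ _)))) -map_comp.
  congr sumn; by elim: ts H => //= u ts IH [-> /IH ->].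
rewrite /fsize /ftree enum_msetn big_seq1 (size_canon (Node a _)) /=.
by rewrite -map_comp sumnE big_map.
Qed.

End ForestFacts.

Section RoughPaths.
Variables (R : realType) (A : finType) (T : R).

(* A linear functional on the vector space with basis the forests is given
   by its values on the basis; a family is only looked at for times in
   [0, T]. *)
Notation functional := (forest A -> R).

Definition dirac_forest (h : forest A) : functional := fun k => (h == k)%:R.

Definition star (phi psi : functional) : functional :=
  fun h => \sum_(p <- coprod h) phi p.1 * psi p.2.

Definition character (phi : functional) : Prop :=
  phi (fone A) = 1 /\ forall h k, phi (fmul h k) = phi h * phi k.

Definition holder_norm (gamma : R) (F : R -> R -> R) : \bar R :=
  ereal_sup [set (`|F st.1 st.2| / `|st.2 - st.1| `^ gamma)%:E
    | st in [set st : R * R |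
        [/\ st.1 \in `[0, T], st.2 \in `[0, T] & st.1 != st.2]]].

Definition rough_path (alpha : R) (X : R -> R -> functional) : Prop :=
  [/\ forall s t, s \in `[0, T] -> t \in `[0, T] -> character (X s t),
      forall s u t, s \in `[0, T] -> u \in `[0, T] -> t \in `[0, T] ->
        star (X s u) (X u t) =1 X s t
    & forall h, (holder_norm (alpha * (fsize h)%:R)
                   (fun s t => X s t h) < +oo)%E].

Definition level (alpha : R) : nat := Num.truncn alpha^-1.

(* the maximum over a finite set, written as a supremum *)
Definition rho (alpha : R) (X Y : R -> R -> functional) : \bar R :=
  ereal_sup [set holder_norm ((fsize h)%:R * alpha)
                   (fun s t => X s t h - Y s t h)
            | h in Fle_pos (level alpha)].

Definition smooth (f : R -> R) : Prop :=
  forall n t, derivable (derive1n n f) t 1.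

(* smoothness on the closed interval: restriction of a smooth function *)
Definition smooth_on (f : R -> R) : Prop :=
  exists2 g, smooth g & {in `[0, T], f =1 g}.

(* int_s^t f(r) dr, with the usual sign when t < s *)
Definition oriented_integral (s t : R) (f : R -> R) : R :=
  if s <= t then \int[lebesgue_measure]_(r in `[s, t]) f r
  else - \int[lebesgue_measure]_(r in `[t, s]) f r.

(* The path is the restriction of x to [0, T]. *)
Definition canonical_lift (x : A -> R -> R) (X : R -> R -> functional) : Prop :=
  (forall s t, s \in `[0, T] -> t \in `[0, T] -> character (X s t)) /\
  (forall a h s t, s \in `[0, T] -> t \in `[0, T] ->
     X s t (ftree (graft a h)) =
       oriented_integral s t (fun r => X s r h * derive1 (x a) r)).

Definition smooth_rough_path (X : R -> R -> functional) : Prop :=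
  exists x : A -> R -> R, (forall a, smooth (x a)) /\ canonical_lift x X.

(* Elements of the span of the forests with at most (level alpha).-1 nodes are
   given by their coordinates, so that <h, Z_t> is Z t h. *)
Definition span_path (alpha : R) (Z : R -> forest A -> R) : Prop :=
  forall t h, t \in `[0, T] -> ~ Fle (level alpha).-1 h -> Z t h = 0.

Definition remainder (alpha : R) (X : R -> R -> functional)
    (Z : R -> forest A -> R) (h : forest A) (s t : R) : R :=
  Z t h - \sum_(k \in Fle (level alpha).-1)
             star (X s t) (dirac_forest h) k * Z s k.

Definition cnorm (alpha gamma : R) (X : R -> R -> functional)
    (Z : R -> forest A -> R) : \bar R :=
  (\sum_(h \in Fle (level alpha).-1)
     (`|Z 0 h|%:E +
      holder_norm ((level alpha - fsize h)%N%:R * gamma)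
        (remainder alpha X Z h)))%E.

Definition cdist (alpha gamma : R) (X Y : R -> R -> functional)
    (Z W : R -> forest A -> R) : \bar R :=
  (\sum_(h \in Fle (level alpha).-1)
     (`|Z 0 h - W 0 h|%:E +
      holder_norm ((level alpha - fsize h)%N%:R * gamma)
        (fun s t => (remainder alpha X Z h s t - remainder alpha Y W h s t)%R)))%E.

Definition controlled (alpha : R) (X : R -> R -> functional)
    (Z : R -> forest A -> R) : Prop :=
  span_path alpha Z /\ (cnorm alpha alpha X Z < +oo)%E.

Definition controlled_closure (alpha beta : R) (X : R -> R -> functional)
    (Z : R -> forest A -> R) : Prop :=
  [/\ span_path alpha Z, (cnorm alpha beta X Z < +oo)%E
    & forall e : R, 0 < e -> exists2 W, controlled alpha X W &
        (cnorm alpha beta X (fun t h => (Z t h - W t h)%R) < e%:E)%E].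

End RoughPaths.

(* Main.v *)
Require Import Defs.
From HB Require Import structures.
From mathcomp Require Import all_boot all_order all_algebra finmap multiset.
From mathcomp Require Import all_classical all_reals all_analysis.
From mathcomp Require Import ring lra zify.

(** By the triangle inequality it is enough to approximate a path W of the
    dense subspace.  Write G_(s,t) for the transport h |-> <X_(s,t) * h, .>
    along a smooth rough path X' close to X, so that G_(u,t) G_(s,u) = G_(s,t)
    by Chen's relation and coassociativity, and R_(s,t) = W_t - G_(s,t) W_s is
    the remainder.  On a grid of mesh d put
      Y_t = sum_i phi_i(t) G_(t_i,t) W_(t_i)
    for a smooth partition of unity (phi_i).  Then Y is smooth and equals W on
    the grid, its remainder inside a cell [u, v] is
    (phi(t) - phi(s)) G_(v,t) R_(u,v), and remainders of adjacent intervals are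
    composed with R_(s,t) = R_(u,t) + G_(u,t) R_(s,u).  Once X' is close to X,
    depending on d, the remainder of Y is therefore bounded in the alpha-scale
    by a constant independent of d, while Y - W = O(d^alpha) uniformly;
    interpolation between these two bounds gives convergence in the
    beta-scale. *)

Set Implicit Arguments.
Unset Strict Implicit.
Unset Printing Implicit Defensive.

Import Order.TTheory GRing.Theory Num.Theory.
Import numFieldNormedType.Exports.

Local Open Scope classical_set_scope.
Local Open Scope ring_scope.

(** * Coproduct, convolution and transport *)

Section Coalgebra.
Variable A : finType.
Implicit Types h k l : forest A.

Lemma enum_fmul h k :
  perm_eq (enum_mset (fmul h k)) (enum_mset h ++ enum_mset k).
Proof.
apply/eq_seq_msetP; rewrite seq_mset_id; apply/msetP => t.
by rewrite mset_seqE count_cat !count_mem_mset /fmul msetE2.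
Qed.

Lemma fsize_one : fsize (fone A) = 0%N.
Proof. by rewrite /fsize /fone enum_mset0 big_nil. Qed.

Lemma fsize_mul h k : fsize (fmul h k) = (fsize h + fsize k)%N.
Proof. by rewrite /fsize (perm_big _ (enum_fmul h k)) big_cat. Qed.

(** The induction principle matching the three rules of the coproduct. Strong induction on the
    number of nodes combines with an inner induction that splits off one tree at a time; removing
    the root of a tree lowers the node count. *)
Lemma forest_ind (P : forest A -> Prop) :
  P (fone A) -> (forall h k, P h -> P k -> P (fmul h k)) ->
  (forall a h, P h -> P (ftree (graft a h))) -> forall h, P h.
Proof.
move=> P1 PM PB h; have [n] := ubnP (fsize h); elim: n h => // n IH h.
rewrite ltnS -[h]seq_mset_id; elim: (enum_mset h) => [|t s IHs].
  by move=> _; rewrite (_ : seq_mset [::] = fone A)//; apply/msetP => t; rewrite mset_seqE mset0E.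
rewrite (_ : seq_mset (t :: s) = fmul (ftree t) (seq_mset s)); last first.
  by apply/msetP => u; rewrite /fmul /ftree msetE2 !mset_seqE /= msetnE (eq_sym u); case: eqP.
rewrite fsize_mul => H; apply: PM; last by apply: IHs; apply: leq_trans H; rewrite leq_addl.
have [a [k tE]] := graft_ex t; rewrite tE; apply: PB; apply: IH.
by move: H; rewrite tE fsize_graft addSn; apply: leq_trans; rewrite ltnS leq_addr.
Qed.

Lemma fsize_eq0 h : fsize h = 0%N -> h = fone A.
Proof.
elim/forest_ind: h => // [h k IHh IHk|a h _]; last by rewrite fsize_graft.
rewrite fsize_mul => /eqP; rewrite addn_eq0 => /andP[/eqP/IHh-> /eqP/IHk->].
by rewrite /fmul /fone mset0D.
Qed.

(** The coproduct is graded. This is what makes Hölder exponents add up under transport and what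
    makes truncation harmless. *)
Lemma fsize_coprod h p : p \in coprod h -> (fsize p.1 + fsize p.2 = fsize h)%N.
Proof.
elim/forest_ind: h p => [p|h k IHh IHk p|a h IH p].
- by rewrite coprod_one inE => /eqP ->; rewrite fsize_one.
- rewrite (perm_mem (coprod_mul h k)) => /allpairsP[[q r]/= [/IHh + /IHk + ->]]/=.
  by rewrite !fsize_mul => <- <-; rewrite addnACA.
- rewrite (perm_mem (coprod_graft a h)) inE => /predU1P[->|/mapP[q /IH + ->]]/=.
    by rewrite fsize_one addn0.
  by rewrite !fsize_graft addnS => ->.
Qed.

Section Sums.
Variable V : nmodType.

Lemma big_coprod_one (F : forest A * forest A -> V) :
  \sum_(p <- coprod (fone A)) F p = F (fone A, fone A).
Proof. by rewrite coprod_one big_seq1. Qed.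

Lemma big_coprod_mul h k (F : forest A * forest A -> V) :
  \sum_(p <- coprod (fmul h k)) F p =
  \sum_(p <- coprod h) \sum_(q <- coprod k) F (fmul p.1 q.1, fmul p.2 q.2).
Proof. by rewrite (perm_big _ (coprod_mul h k)) big_tmul. Qed.

Lemma big_coprod_graft a h (F : forest A * forest A -> V) :
  \sum_(p <- coprod (ftree (graft a h))) F p =
  F (ftree (graft a h), fone A) +
  \sum_(p <- coprod h) F (p.1, ftree (graft a p.2)).
Proof. by rewrite (perm_big _ (coprod_graft a h)) big_cons big_map. Qed.

(** Testing against an arbitrary [F] avoids triple tensors. For a product, the hypothesis for [h] is
    applied with the sums over [k] kept inside [F], and then the one for [k]; for a grafted tree,
    the term with right factor [fone A] produces the extra summands on both sides. *)
Lemma coprod_coassoc h (F : forest A -> forest A -> forest A -> V) :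
  \sum_(p <- coprod h) \sum_(q <- coprod p.2) F p.1 q.1 q.2 =
  \sum_(p <- coprod h) \sum_(q <- coprod p.1) F q.1 q.2 p.2.
Proof.
elim/forest_ind: h F => [F|h k IHh IHk F|a h IH F].
- by rewrite !big_coprod_one.
- rewrite !big_coprod_mul /=.
  transitivity (\sum_(p <- coprod h) \sum_(q <- coprod p.2)
     \sum_(p' <- coprod k) \sum_(q' <- coprod p'.2)
        F (fmul p.1 p'.1) (fmul q.1 q'.1) (fmul q.2 q'.2)).
    apply: eq_bigr => p _; rewrite [RHS]exchange_big /=; apply: eq_bigr => p' _.
    by rewrite big_coprod_mul.
  rewrite (IHh (fun x y z => \sum_(p' <- coprod k) \sum_(q' <- coprod p'.2)
        F (fmul x p'.1) (fmul y q'.1) (fmul z q'.2))).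
  apply: eq_bigr => p _; rewrite [RHS](_ : _ = \sum_(p' <- coprod k)
     \sum_(q <- coprod p.1) \sum_(q' <- coprod p'.1)
      F (fmul q.1 q'.1) (fmul q.2 q'.2) (fmul p.2 p'.2)).
    rewrite [RHS]exchange_big /=; apply: eq_bigr => q _.
    by rewrite (IHk (fun x y z => F (fmul q.1 x) (fmul q.2 y) (fmul p.2 z))).
  by apply: eq_bigr => p' _; rewrite big_coprod_mul.
- rewrite !big_coprod_graft /= big_coprod_one /= -addrA; congr +%R.
  rewrite -(IH (fun x y z => F x y (ftree (graft a z)))) -big_split /=.
  by apply: eq_bigr => p _; rewrite big_coprod_graft.
Qed.

End Sums.

Lemma coprod_counit (R : pzRingType) h (F : forest A -> R) :
  \sum_(p <- coprod h) (p.1 == fone A)%:R * F p.2 = F h.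
Proof.
elim/forest_ind: h F => [F|h k IHh IHk F|a h IH F].
- by rewrite big_coprod_one eqxx mul1r.
- rewrite big_coprod_mul -[RHS](IHh (fun x => F (fmul x k))); apply: eq_bigr => p _.
  rewrite -(IHk (fun x => F (fmul p.2 x))) big_distrr/=; apply: eq_bigr => q _ /=.
  rewrite mulrA -natrM mulnb; congr ((nat_of_bool _)%:R * _).
  apply/eqP/andP => [/(congr1 (@fsize A))|[/eqP-> /eqP->]]; last by rewrite /fmul mset0D.
  rewrite fsize_mul fsize_one => /eqP; rewrite addn_eq0.
  by move=> /andP[/eqP/fsize_eq0-> /eqP/fsize_eq0->]; rewrite eqxx.
- rewrite big_coprod_graft /= (negbTE (_ : _ != _)) ?mul0r ?add0r.
    exact: (IH (fun x => F (ftree (graft a x)))).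
  by apply/eqP => /(congr1 (@fsize A)); rewrite fsize_graft fsize_one.
Qed.

Section Star.
Variable R : realType.
Implicit Types phi psi chi z : forest A -> R.

Lemma starA phi psi chi : star phi (star psi chi) = star (star phi psi) chi.
Proof.
apply/funext => h; rewrite /star.
under eq_bigr do rewrite big_distrr /=.
under [RHS]eq_bigr do rewrite big_distrl /=.
rewrite (coprod_coassoc h (fun a b c => phi a * (psi b * chi c))).
by apply: eq_bigr => p _; apply: eq_bigr => q _; rewrite mulrA.
Qed.

Definition counit : forest A -> R := fun h => (h == fone A)%:R.

Lemma star_counit phi : star counit phi = phi.
Proof. by apply/funext => h; exact: coprod_counit. Qed.

(* The action of phi on the dual of the span of the forests with at most n
   nodes: a controlled path is transported from s to t by [trans n (X s t)]. *)
Definition trans n phi z : forest A -> R :=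
  fun h => \sum_(k \in Fle n) star phi (dirac_forest R h) k * z k.

(** By the grading, a forest with at most [n] nodes has no right factor in its coproduct with more
    than [n] nodes. *)
Lemma trans_out n phi z h : ~ Fle n h -> trans n phi z h = 0.
Proof.
move=> hn; rewrite /trans fsbig1// => k kn; rewrite /star big_seq big1 ?mul0r// => p pk.
rewrite /dirac_forest; case: eqP => [hp|]; last by rewrite mulr0.
by case: hn; rewrite /Fle/= hp (leq_trans _ kn)// -(fsize_coprod pk) leq_addl.
Qed.

Lemma transB n phi z w : trans n phi (z \- w) = trans n phi z \- trans n phi w.
Proof.
apply/funext => h; rewrite /trans/= !(fsbig_finite _ _ (finite_Fle A n))//=.
by rewrite -sumrB; apply: eq_bigr => k _; rewrite mulrBr.
Qed.

Lemma transZ n phi c z : trans n phi (c \*o z) = c \*o trans n phi z.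
Proof.
apply/funext => h; rewrite /trans/= !(fsbig_finite _ _ (finite_Fle A n))//=.
by rewrite big_distrr; apply: eq_bigr => k _ /=; rewrite mulrCA.
Qed.

Lemma trans_subl n phi psi z : trans n (phi \- psi) z = trans n phi z \- trans n psi z.
Proof.
apply/funext => h; rewrite /trans/= !(fsbig_finite _ _ (finite_Fle A n))//=.
rewrite -sumrB; apply: eq_bigr => k _; rewrite /star/= -mulrBl -sumrB; congr *%R.
by apply: eq_bigr => p _; rewrite mulrBl.
Qed.

Lemma trans_counit n z h : Fle n h -> trans n counit z h = z h.
Proof.
move=> hn; rewrite /trans star_counit (fsbigD1 h)//; last exact: sub_finite_set (finite_Fle A n).
rewrite /dirac_forest/= eqxx mul1r fsbig1 ?addr0// => k [_ /eqP].
by rewrite eq_sym => /negbTE ->; rewrite mul0r.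
Qed.

(** Coassociativity in dual form, hence the reversed order of [phi] and [psi]. Truncating the
    intermediate sum loses nothing: right factors of a forest with at most [n] nodes again have at
    most [n] nodes. *)
Lemma trans_comp n phi psi z :
  trans n psi (trans n phi z) = trans n (star phi psi) z.
Proof.
apply/funext => h; rewrite /trans.
rewrite !(fsbig_finite _ _ (finite_Fle A n))/=.
under eq_bigr do rewrite (fsbig_finite _ _ (finite_Fle A n))/= big_distrr/=.
rewrite exchange_big/= big_seq [RHS]big_seq; apply: eq_bigr => l.
rewrite in_fset_set ?inE; last exact: finite_Fle.
move=> ln; under eq_bigr do rewrite mulrA.
rewrite -big_distrl/=; congr *%R; rewrite -starA {2}/star.
under eq_bigr do rewrite mulrC {1}/star big_distrl/=.
rewrite exchange_big/= big_seq [RHS]big_seq; apply: eq_bigr => p pl.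
have pn : p.2 \in fset_set (Fle n).
  rewrite in_fset_set ?inE/=; last exact: finite_Fle.
  by rewrite /Fle/= (leq_trans _ ln)// -(fsize_coprod pl) leq_addl.
rewrite (big_fsetD1 _ pn)/= big1_fset ?addr0; last first.
  by move=> k; rewrite !inE => /andP[/negbTE kp _] _; rewrite /dirac_forest kp mulr0 mul0r.
by rewrite /dirac_forest eqxx mulr1.
Qed.

(** A crude count of all terms that can occur in a transport, uniform in the target forest. *)
Definition trans_card n : nat := (\sum_(k \in @Fle A n) size (coprod k))%N.

Lemma le_trans_card n phi z h (B : R) : 0 <= B ->
  (forall k p, Fle n k -> p \in coprod k -> p.2 = h -> `|phi p.1 * z k| <= B) ->
  `|trans n phi z h| <= (trans_card n)%:R * B.
Proof.
move=> B0 H; rewrite /trans /trans_card !(fsbig_finite _ _ (finite_Fle A n))/=.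
rewrite natr_sum big_distrl/=; apply: le_trans (ler_norm_sum _ _ _) _.
rewrite big_seq [leRHS]big_seq; apply: ler_sum => k.
rewrite in_fset_set ?inE; last exact: finite_Fle.
move=> kn; rewrite /star big_distrl/=; apply: le_trans (ler_norm_sum _ _ _) _.
rewrite -sum1_size natr_sum big_distrl/=.
rewrite big_seq [leRHS]big_seq; apply: ler_sum => p pk; rewrite mul1r.
rewrite /dirac_forest; case: eqP => [hp|_]; last by rewrite mulr0 mul0r normr0.
by rewrite mulr1; exact: H pk _.
Qed.

End Star.
End Coalgebra.

(** * Smooth functions and the fundamental theorem of calculus *)

Section Smooth.
Variable R : realType.
Implicit Types f g : R -> R.

Lemma smooth_coind (S : (R -> R) -> Prop) :
  (forall f, S f -> exists2 g, S g & forall x, is_derive x (1 : R) f (g x)) ->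
  forall f, S f -> smooth f.
Proof.
move=> HS f Sf n t.
have : exists2 g, S g & forall x, is_derive x (1 : R) (derive1n n f) (g x).
  elim: n => [|n [g Sg dg]]; first exact: HS.
  rewrite (_ : derive1n n.+1 f = g); first exact: HS.
  by apply/funext => x; rewrite derive1nS derive1E; exact: derive_val.
by case=> g _ /(_ t)/@ex_derive.
Qed.

Lemma smooth_deriv f : smooth f -> smooth (derive1 f).
Proof. by move=> sf n t; rewrite -derive1Sn; exact: sf. Qed.

Lemma smooth_is_derive f x : smooth f -> is_derive x (1 : R) f (derive1 f x).
Proof. by move=> sf; rewrite derive1E; apply: derivableP; exact: (sf 0%N). Qed.

Lemma smooth_continuous f : smooth f -> continuous f.
Proof.
by move=> sf x; apply/differentiable_continuous/derivable1_diffP; exact: (sf 0%N).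
Qed.

(* Unlike [smooth], this family is visibly closed under derivatives, so that
   [smooth_coind] gives all the closure properties of [smooth] at once. *)
Inductive smooth_expr : (R -> R) -> Prop :=
| SmoothBase f of smooth f : smooth_expr f
| SmoothCst (c : R) : smooth_expr (fun=> c)
| SmoothAdd f g of smooth_expr f & smooth_expr g : smooth_expr (f \+ g)
| SmoothMul f g of smooth_expr f & smooth_expr g : smooth_expr (f \* g)
| SmoothAff f (a b : R) of smooth_expr f : smooth_expr (fun x => f (a * x + b))
| SmoothPrim f g of smooth_expr g & (forall x, is_derive x (1 : R) f (g x)) :
    smooth_expr f.

Lemma smooth_expr_smooth f : smooth_expr f -> smooth f.
Proof.
apply: smooth_coind f => f; elim.
- move=> {}f sf; exists (derive1 f); first exact/SmoothBase/smooth_deriv.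
  by move=> x; exact: smooth_is_derive.
- by move=> c; exists (fun=> 0); [exact: SmoothCst|move=> x; exact: is_derive_cst].
- move=> {}f g _ [f' Sf' df'] _ [g' Sg' dg']; exists (f' \+ g'); first exact: SmoothAdd.
  by move=> x; exact: is_deriveD.
- move=> {}f g Sf [f' Sf' df'] Sg [g' Sg' dg']; exists (f \* g' \+ g \* f').
    by apply: SmoothAdd; exact: SmoothMul.
  by move=> x; exact: is_deriveM.
- move=> {}f a b Sf [f' Sf' df']; exists ((fun=> a) \* (fun x => f' (a * x + b))).
    by apply: SmoothMul; [exact: SmoothCst|exact: SmoothAff].
  move=> x; have daff : is_derive x (1 : R) (fun y => a * y + b) a.
    have h1 := is_deriveZ a (is_derive_id x (1 : R)).
    have := is_deriveD h1 (is_derive_cst b x (1 : R)).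
    by rewrite addr0 /GRing.scale/= mulr1.
  by rewrite /= mulrC; exact: (@is_derive1_comp _ f (fun y => a * y + b) x _ _ (df' _) daff).
- by move=> {}f g Sg _ df; exists g.
Qed.

Lemma smooth_cst (c : R) : smooth (fun=> c).
Proof. exact/smooth_expr_smooth/SmoothCst. Qed.

Lemma smoothD f g : smooth f -> smooth g -> smooth (f \+ g).
Proof. by move=> *; apply/smooth_expr_smooth/SmoothAdd; exact: SmoothBase. Qed.

Lemma smoothM f g : smooth f -> smooth g -> smooth (f \* g).
Proof. by move=> *; apply/smooth_expr_smooth/SmoothMul; exact: SmoothBase. Qed.

Lemma smooth_affine f a b : smooth f -> smooth (fun x => f (a * x + b)).
Proof. by move=> *; apply/smooth_expr_smooth/SmoothAff; exact: SmoothBase. Qed.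

Lemma smooth_prim f g : smooth g -> (forall x, is_derive x (1 : R) f (g x)) ->
  smooth f.
Proof.
by move=> sg df; apply: smooth_expr_smooth; exact: SmoothPrim (SmoothBase sg) df.
Qed.

Section FTC.
Variable f : R -> R.
Hypothesis cf : continuous f.
Let mu := @lebesgue_measure R.

Let intf a b : mu.-integrable `[a, b] (EFin \o f).
Proof.
apply: continuous_compact_integrable; first exact: segment_compact.
by apply: continuous_subspaceT => x.
Qed.

(** Moving to a common base point removes the case distinction on the order of [s] and [t]. *)
Lemma oriented_integralB a s t : a <= s -> a <= t ->
  oriented_integral s t f =
  \int[mu]_(r in `[a, t]) f r - \int[mu]_(r in `[a, s]) f r.
Proof.
have key u v : a <= u -> u <= v -> \int[mu]_(r in `[u, v]) f r =
    \int[mu]_(r in `[a, v]) f r - \int[mu]_(r in `[a, u]) f r.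
  move=> au uv; rewrite Rintegral_itvB; [|exact: intf|by rewrite bnd_simp|by rewrite bnd_simp].
  rewrite Rintegral_itv_obnd_cbnd//.
  by apply: integrableS (intf u v) => //; apply: subset_itv; rewrite bnd_simp.
move=> sa ta; rewrite /oriented_integral; case: leP => [st|/ltW ts].
  exact: key.
by rewrite (key t s)// opprB.
Qed.

Lemma is_derive_oriented_integral s t :
  is_derive t (1 : R) (fun u => oriented_integral s u f) (f t).
Proof.
(* Strictly to the left of both points, so that [t] is interior to [[a, t + 1]] and the derivative
   there is two-sided. *)
pose a := Num.min s t - 1.
have [lsa lta] : a < s /\ a < t.
  by rewrite /a !ltrBlDr !gt_min; split; apply/orP; [left|right]; rewrite ltrDl.
have t1 : t < t + 1 by rewrite ltrDl.
have [dF F'] := continuous_FTC1_closed t1 (intf a _) lta (@cf t).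
pose F u := \int[mu]_(r in `[a, u]) f r.
apply: (@near_eq_is_derive _ _ _ (fun u => F u - F s)).
- near=> u; rewrite (@oriented_integralB a)// ltW//.
  by near: u; exact: lt_nbhsr.
- rewrite -[f t]subr0; apply: is_deriveB; rewrite -F' derive1E; exact: derivableP.
Unshelve. all: by end_near. Qed.
End FTC.
End Smooth.

(** * Canonical lifts of smooth paths *)

Section OrientedIntegral.
Variable R : realType.
Implicit Types f g : R -> R.
Let mu := @lebesgue_measure R.

Lemma oriented_integral_chasles f s u t : continuous f ->
  oriented_integral s u f + oriented_integral u t f = oriented_integral s t f.
Proof.
move=> cf; pose a := Num.min s (Num.min u t).
have [as_ au at_] : [/\ a <= s, a <= u & a <= t].
  by rewrite /a !ge_min !lexx !orbT.
by rewrite !(oriented_integralB cf (a := a))// [LHS]addrC addrA subrK.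
Qed.

Lemma eq_oriented_integral (T s t : R) f g : s \in `[0, T] -> t \in `[0, T] ->
  {in `[0, T], f =1 g} -> oriented_integral s t f = oriented_integral s t g.
Proof.
have key u v : u \in `[0, T] -> v \in `[0, T] -> {in `[0, T], f =1 g} ->
    \int[mu]_(r in `[u, v]) f r = \int[mu]_(r in `[u, v]) g r.
  move=> uT vT fg; apply: eq_Rintegral => r; rewrite inE/= in_itv/= => /andP[ur rv].
  apply: fg; move: uT vT; rewrite !in_itv/= => /andP[u0 _] /andP[_ vT].
  by rewrite (le_trans u0 ur) (le_trans rv vT).
by move=> sT tT fg; rewrite /oriented_integral; case: leP => _; rewrite key.
Qed.

Lemma oriented_integral_refl s f : oriented_integral s s f = 0.
Proof. by rewrite /oriented_integral lexx set_itv1 Rintegral_set1. Qed.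

Lemma oriented_integral_lin c f g s t : continuous f -> continuous g ->
  oriented_integral s t (fun r => c * f r + g r) =
  c * oriented_integral s t f + oriented_integral s t g.
Proof.
move=> cf cg.
have I h u v : continuous h -> mu.-integrable `[u, v] (EFin \o h).
  move=> ch; apply: continuous_compact_integrable; first exact: segment_compact.
  by apply: continuous_subspaceT => x.
have ccf : continuous (fun r => c * f r) by move=> x; apply: cvgM; [exact: cvg_cst|exact: cf].
rewrite /oriented_integral; case: leP => _.
  by rewrite RintegralD//; [rewrite RintegralZl//; exact: I|exact: I|exact: I].
by rewrite RintegralD//; [rewrite RintegralZl ?mulrN ?opprD//; exact: I|exact: I|exact: I].
Qed.

Lemma smooth_sum (I : Type) (r : seq I) (f : I -> R -> R) :
  (forall i, smooth (f i)) -> smooth (fun x => \sum_(i <- r) f i x).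
Proof.
move=> sf; elim: r => [|i r IH].
  by under eq_fun do rewrite big_nil; exact: smooth_cst.
by under eq_fun do rewrite big_cons; exact: smoothD.
Qed.

Lemma oriented_integral_sum (I : Type) (r : seq I) (c : I -> R) (f : I -> R -> R) s t :
  (forall i, smooth (f i)) ->
  oriented_integral s t (fun x => \sum_(i <- r) c i * f i x) =
  \sum_(i <- r) c i * oriented_integral s t (f i).
Proof.
move=> sf; elim: r => [|i r IH].
  rewrite big_nil; under eq_fun do rewrite big_nil.
  by rewrite /oriented_integral; case: leP => _; rewrite Rintegral_cst ?mul0r ?oppr0.
under eq_fun do rewrite big_cons.
rewrite oriented_integral_lin ?big_cons ?IH//; apply: smooth_continuous => //.
by apply: smooth_sum => j; apply: smoothM => //; exact: smooth_cst.
Qed.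

End OrientedIntegral.

(** * Smooth functions on the time interval *)

Section SmoothOn.
Variables (R : realType) (T : R).
Implicit Types f g : R -> R.

Lemma eq_smooth_on f g : {in `[0, T], f =1 g} -> smooth_on T f -> smooth_on T g.
Proof. by move=> fg [h sh fh]; exists h => // x xT; rewrite -fg// fh. Qed.

Lemma smooth_on_smooth f : smooth f -> smooth_on T f.
Proof. by exists f. Qed.

Lemma smooth_onD f g : smooth_on T f -> smooth_on T g -> smooth_on T (f \+ g).
Proof.
by move=> [f' sf ff] [g' sg gg]; exists (f' \+ g'); [exact: smoothD|move=> x xT /=; rewrite ff ?gg].
Qed.

Lemma smooth_onM f g : smooth_on T f -> smooth_on T g -> smooth_on T (f \* g).
Proof.
by move=> [f' sf ff] [g' sg gg]; exists (f' \* g'); [exact: smoothM|move=> x xT /=; rewrite ff ?gg].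
Qed.

Lemma smooth_on_sum (I : eqType) (r : seq I) (f : I -> R -> R) :
  (forall i, i \in r -> smooth_on T (f i)) ->
  smooth_on T (fun x => \sum_(i <- r) f i x).
Proof.
elim: r => [|i r IH] sf.
  by under eq_fun do rewrite big_nil; exact/smooth_on_smooth/smooth_cst.
under eq_fun do rewrite big_cons; apply: smooth_onD; first by apply: sf; rewrite mem_head.
by apply: IH => j jr; apply: sf; rewrite inE jr orbT.
Qed.

End SmoothOn.

(** * Smoothness, diagonal values and Chen's relation for canonical lifts *)

Section CanonicalLift.
Variables (R : realType) (A : finType) (T : R).
Variables (x : A -> R -> R) (X : R -> R -> forest A -> R).
Hypothesis sx : forall a, smooth (x a).
Hypothesis liftX : canonical_lift T x X.

Let X1 s t : s \in `[0, T] -> t \in `[0, T] -> X s t (fone A) = 1.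
Proof. by move=> sT tT; have [/(_ s t sT tT)[]] := liftX. Qed.

Let XM s t h k : s \in `[0, T] -> t \in `[0, T] ->
  X s t (fmul h k) = X s t h * X s t k.
Proof. by move=> sT tT; have [/(_ s t sT tT)[_ ->]] := liftX. Qed.

(** The lift is controlled only for times in [[0, T]]; the integrand can thus be exchanged for a
    function [g] that is smooth on the whole line, to which the calculus lemmas apply. *)
Lemma canonical_lift_graft a h s t g : s \in `[0, T] -> t \in `[0, T] ->
  {in `[0, T], X s ^~ h =1 g} ->
  X s t (ftree (graft a h)) = oriented_integral s t (fun r => g r * derive1 (x a) r).
Proof.
move=> sT tT Xg; have [_ ->//] := liftX.
by apply: (eq_oriented_integral sT tT) => r rT; rewrite -Xg.
Qed.

Lemma canonical_lift_smooth s h : s \in `[0, T] -> smooth_on T (X s ^~ h).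
Proof.
move=> sT; elim/forest_ind: h => [|h k IHh IHk|a h [g sg Xg]].
- by exists (fun=> 1) => [|t tT]; [exact: smooth_cst|rewrite X1].
- by apply: eq_smooth_on (smooth_onM IHh IHk) => t tT; rewrite XM.
- have sgx : smooth (g \* derive1 (x a)) by apply: smoothM => //; exact: smooth_deriv.
  exists (fun t => oriented_integral s t (g \* derive1 (x a))).
    apply: (smooth_prim sgx) => t.
    exact: (is_derive_oriented_integral (smooth_continuous sgx)).
  by move=> t tT; rewrite (canonical_lift_graft _ sT tT Xg).
Qed.

Lemma canonical_lift_diag s : s \in `[0, T] -> X s s = counit R (A := A).
Proof.
move=> sT; apply/funext => h; elim/forest_ind: h => [|h k IHh IHk|a h _].
- by rewrite X1// /counit eqxx.
- rewrite XM// IHh IHk /counit -natrM mulnb; congr (nat_of_bool _)%:R.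
  apply/andP/eqP => [[/eqP-> /eqP->]|/(congr1 (@fsize A))]; first by rewrite /fmul mset0D.
  rewrite fsize_mul fsize_one => /eqP; rewrite addn_eq0.
  by move=> /andP[/eqP/fsize_eq0-> /eqP/fsize_eq0->]; rewrite eqxx.
- rewrite (@canonical_lift_graft a h s s (X s ^~ h))// oriented_integral_refl /counit.
  by case: eqP => // /(congr1 (@fsize A)); rewrite fsize_graft fsize_one.
Qed.

(** For a grafted tree the integral from [s] to [t] is cut at [u]. The piece up to [u] is the term
    of the coproduct with right factor [fone A]; in the other piece the induction hypothesis expands
    the integrand, and linearity of the integral gives the remaining terms. *)
Lemma canonical_lift_chen s u t :
  s \in `[0, T] -> u \in `[0, T] -> t \in `[0, T] ->
  star (X s u) (X u t) = X s t.
Proof.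
move=> sT uT tT; apply/funext => h.
elim/forest_ind: h t tT => [|h k IHh IHk|a h IH] t tT.
- by rewrite /star big_coprod_one !X1 ?mulr1.
- rewrite XM// -IHh// -IHk// /star big_coprod_mul big_distrl/=.
  apply: eq_bigr => p _; rewrite big_distrr/=; apply: eq_bigr => q _.
  by rewrite !XM// mulrACA.
- have /choice[g gP] : forall k, exists g, smooth g /\ {in `[0, T], X u ^~ k =1 g}.
    by move=> k; have [g sg Xg] := canonical_lift_smooth k uT; exists g.
  pose c (p : forest A * forest A) := X s u p.1.
  pose f (p : forest A * forest A) := g p.2 \* derive1 (x a).
  have sf p : smooth (f p).
    by apply: smoothM; [have [] := gP p.2|exact: smooth_deriv].
  have XE r : r \in `[0, T] -> X s r (ftree (graft a h)) =
      oriented_integral s r (fun r => \sum_(p <- coprod h) c p * f p r).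
    move=> rT; rewrite (@canonical_lift_graft a h s r
      (fun r => \sum_(p <- coprod h) c p * g p.2 r))//.
      congr oriented_integral; apply/funext => v; rewrite big_distrl/=.
      by apply: eq_bigr => p _; rewrite /f/= mulrA.
    move=> v vT /=; rewrite -IH// /star; apply: eq_bigr => p _.
    by have [_ ->] := gP p.2.
  rewrite /star big_coprod_graft/= X1// mulr1 !XE//.
  rewrite -(@oriented_integral_chasles _ _ s u t); last first.
    by apply/smooth_continuous/smooth_sum => p; apply: smoothM => //; exact: smooth_cst.
  congr +%R; rewrite oriented_integral_sum//; apply: eq_bigr => p _; congr *%R.
  by apply: canonical_lift_graft => //; have [] := gP p.2.
Qed.

End CanonicalLift.

(** * A smooth step function *)

Section SmoothStep.
Variable R : realType.
Implicit Types (p : {poly R}) (x y : R).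

Lemma exprn_le_expR n y : 0 <= y -> y ^+ n <= n`!%:R * expR y.
Proof.
move=> y0; case: n => [|n]; first by rewrite expr0 fact0 mul1r -expR0 ler_expR.
have f0 : 0 < n.+1`!%:R :> R by rewrite ltr0n fact_gt0.
by rewrite mulrC -ler_pdivrMr//; apply: le_trans (expR_ge1Dxn n y0); rewrite lerDr.
Qed.

Lemma horner_le_expR p : exists2 C : R, 0 <= C &
  forall y, 0 <= y -> `|p.[y]| <= C * expR y.
Proof.
exists (\sum_(i < size p) `|p`_i| * i`!%:R); first by apply: sumr_ge0 => i _; rewrite mulr_ge0.
move=> y y0; rewrite horner_coef big_distrl/=.
apply: le_trans (ler_norm_sum _ _ _) _; apply: ler_sum => i _.
rewrite normrM normrX (ger0_norm y0) -mulrA.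
by rewrite ler_wpM2l// exprn_le_expR.
Qed.

(* The family of the functions [exp_flat p] is closed under differentiation;
   its member p = 1 is the usual flat function exp(-1/x). *)
Definition exp_flat p x : R := if 0 < x then p.[x^-1] * expR (- x^-1) else 0.

(** The exponential beats the polynomial ['X^2 * p] in the variable [x^-1], which yields the factor
    [x ^+ 2]. A quadratic bound is what differentiability at 0 requires. *)
Lemma exp_flat_le p : exists2 C : R, 0 <= C &
  forall x, `|exp_flat p x| <= C * `|x| ^+ 2.
Proof.
have [C C0 HC] := horner_le_expR ('X^2 * p); exists C => // x.
rewrite /exp_flat; case: ltP => [x0|_]; last by rewrite normr0 mulr_ge0// exprn_ge0.
have y0 : 0 <= x^-1 by rewrite invr_ge0 ltW.
have := HC _ y0; rewrite hornerM hornerXn (normrM _ p.[_]) (normrM p.[_]).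
rewrite (gtr0_norm (expR_gt0 _)) expRN normrX normfV exprVn (gtr0_norm x0).
rewrite mulrC ler_pdivrMr ?exprn_gt0// => H.
by rewrite ler_pdivrMr ?expR_gt0// mulrAC.
Qed.

(** Away from 0 this is the chain rule, the inner derivative [- x ^- 2] producing the factor ['X^2].
    At 0 the difference quotient is at most [C * |h|] by the quadratic bound. *)
Lemma is_derive_exp_flat p x :
  is_derive x (1 : R) (exp_flat p) (exp_flat ('X^2 * (p - p^`()%R)) x).
Proof.
have [x0|x0|->] := ltgtP x 0.
- rewrite {2}/exp_flat ltNge (ltW x0)/=.
  apply: (@near_eq_is_derive _ _ _ (cst 0)).
  near=> y; rewrite /exp_flat/= ltNge ifF//; apply/negbTE; rewrite negbK ltW//.
  by near: y; exact: lt_nbhsl.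
- rewrite {2}/exp_flat x0.
  have xn0 : x != 0 by rewrite gt_eqF.
  apply: (@near_eq_is_derive _ _ _ ((horner p \o (fun y => y^-1)) \*
    (expR \o (fun y => - y^-1)))).
    near=> y; rewrite /exp_flat/= ifT//.
    by near: y; exact: lt_nbhsr.
  have dV : is_derive x (1 : R) (fun y => y^-1) (- x ^- 2).
    have := is_deriveV xn0 (is_derive_id x (1 : R)).
    by rewrite /GRing.scale/= mulr1.
  have dp : is_derive (x^-1) (1 : R) (horner p) (p^`()%R).[x^-1].
    by rewrite derivE derive1E; apply: derivableP; exact: derivable_horner.
  have h1 := @is_derive1_comp _ (horner p) (fun y => y^-1) x _ _ dp dV.
  have h2 := @is_derive1_comp _ expR (fun y => - y^-1) x _ _ (is_derive_expR _) (is_deriveN dV).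
  apply: is_derive_eq (is_deriveM h1 h2) _.
  rewrite /GRing.scale/= hornerM hornerXn hornerD hornerN exprVn; ring.
- rewrite {2}/exp_flat ltxx.
  have [C C0 HC] := exp_flat_le p.
  have H : (fun h : R => h^-1 *: ((exp_flat p \o shift 0) (h *: (1 : R)) - exp_flat p 0)) @ 0^' --> (0 : R).
    apply/norm_cvg0P; apply: (@squeeze_cvgr _ _ _ _ (cst 0) (fun h => C * `|h|)).
    - near=> h; rewrite normr_ge0/= /exp_flat ltxx -/(exp_flat p _) subr0 addr0.
      have h0 : h != 0 by near: h; exact: nbhs_dnbhs_neq.
      rewrite /GRing.scale/= mulr1 normrM normfV mulrC ler_pdivrMr ?normr_gt0//.
      by rewrite -mulrA -expr2.
    - exact: cvg_cst.
    - rewrite -[X in _ --> X](mulr0 C); apply: cvgM; first exact: cvg_cst.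
      rewrite -[X in _ --> X](normr0 R); apply: cvg_norm; exact: nbhs_dnbhs.
  by split; [exact: cvgP H|exact: cvg_lim H].
Unshelve. all: by end_near. Qed.

Lemma smooth_exp_flat p : smooth (exp_flat p).
Proof.
apply: (@smooth_coind R (fun f => exists q, f = exp_flat q)); last by exists p.
move=> _ [q ->]; exists (exp_flat ('X^2 * (q - q^`()%R))); first by eexists.
exact: is_derive_exp_flat.
Qed.

Lemma MVT_derive (f g : R -> R) x y : (forall z, is_derive z (1 : R) f (g z)) ->
  x < y -> exists2 c, c \in `]x, y[ & f y - f x = g c * (y - x).
Proof.
move=> fg xy; apply: MVT => //; apply: continuous_subspaceT => z.
by apply/differentiable_continuous/derivable1_diffP; have [] := fg z.
Qed.

(** The normalised primitive of the bump [E x * E (1 - x)], which is positive exactly on the open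
    unit interval. Since the bump is at most 1, the Lipschitz constant is the normalising factor
    [(F 1)^-1]. *)
Lemma smooth_step : exists theta : R -> R, exists2 L : R, 0 <= L &
  [/\ smooth theta, forall x, x <= 0 -> theta x = 0,
      forall x, 1 <= x -> theta x = 1 &
      forall x y, `|theta x - theta y| <= L * `|x - y|].
Proof.
pose E := exp_flat 1.
have Ege0 x : 0 <= E x.
  by rewrite /E /exp_flat; case: ifP => // _; rewrite hornerC mul1r expR_ge0.
have Ele1 x : E x <= 1.
  rewrite /E /exp_flat; case: ifP => // x0.
  by rewrite hornerC mul1r expR_le1 oppr_le0 invr_ge0 ltW.
have E0 x : x <= 0 -> E x = 0 by rewrite /E /exp_flat ltNge => ->.
have Egt0 x : 0 < x -> 0 < E x.
  by rewrite /E /exp_flat => ->; rewrite hornerC mul1r expR_gt0.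
pose b x := E x * E (-1 * x + 1).
have sE : smooth E by exact: smooth_exp_flat.
have sb : smooth b by apply: (smoothM sE); exact: smooth_affine.
pose F t := oriented_integral 0 t b.
have dF t : is_derive t (1 : R) F (b t).
  exact: (is_derive_oriented_integral (smooth_continuous sb)).
have F0 : F 0 = 0 by rewrite /F /oriented_integral lexx set_itv1 Rintegral_set1.
have Fneg x : x <= 0 -> F x = 0.
  rewrite le_eqVlt => /predU1P[->//|x0].
  have [c] := MVT_derive dF x0; rewrite in_itv/= => /andP[_ c0].
  by rewrite /b E0 ?(ltW c0)// !mul0r F0 sub0r => /eqP; rewrite oppr_eq0 => /eqP.
have F1 : 0 < F 1.
  have [c] := MVT_derive dF ltr01; rewrite in_itv/= => /andP[c0 c1].
  rewrite F0 !subr0 mulr1 => ->; rewrite mulr_gt0// Egt0//; lra.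
have Fpos x : 1 <= x -> F x = F 1.
  rewrite le_eqVlt => /predU1P[<-//|x1].
  have [c] := MVT_derive dF x1; rewrite in_itv/= => /andP[c1 _].
  rewrite /b (E0 (-1 * c + 1)); last lra.
  by rewrite mulr0 mul0r => /eqP; rewrite subr_eq0 => /eqP.
have FL x y : `|F x - F y| <= `|x - y|.
  wlog xy : x y / x < y.
    move=> H; have [xy|yx|->] := ltgtP x y; first exact: H.
      by rewrite distrC (distrC x) H.
    by rewrite !subrr.
  have [c _ cE] := MVT_derive dF xy; rewrite distrC cE (distrC x) normrM.
  rewrite ler_piMl// normrM -[leRHS](mulr1 1) ler_pM// ger0_norm//.
exists (fun x => (F 1)^-1 * F x); exists (F 1)^-1; first by rewrite invr_ge0 ltW.
split.
- by apply: smoothM; [exact: smooth_cst|exact: smooth_prim dF].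
- by move=> x x0; rewrite (Fneg x) ?mulr0.
- by move=> x x1; rewrite (Fpos x)// mulVf// gt_eqF.
- move=> x y; rewrite -mulrBr normrM ger0_norm ?invr_ge0 ?(ltW F1)//.
  by rewrite ler_wpM2l// invr_ge0 ltW.
Qed.

End SmoothStep.

(** * Hölder norms and remainders *)

Section Powers.
Variable R : realType.
Implicit Types x y a b c d e p : R.

Lemma le_powRl x y a : 0 <= a -> 0 <= x -> x <= y -> x `^ a <= y `^ a.
Proof.
move=> a0 x0 xy; apply: ge0_ler_powR => //; rewrite nnegrE//.
exact: le_trans xy.
Qed.

Lemma powR_le_max1 x y a : 0 <= a <= 1 -> 0 <= x -> x <= y -> x `^ a <= Num.max 1 y.
Proof.
move=> /andP[a0 a1] x0 xy; have m1 : 1 <= Num.max 1 y by rewrite le_max lexx.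
apply: (@le_trans _ _ (Num.max 1 y `^ a)).
  by apply: le_powRl => //; rewrite le_max xy orbT.
by apply: le_trans (ler_powR m1 a1) _; rewrite powRr1// (le_trans ler01).
Qed.

Lemma powR_small c e p : 0 < p -> 0 < e -> 0 <= c ->
  exists2 d0, 0 < d0 & forall d, 0 <= d -> d <= d0 -> c * d `^ p <= e.
Proof.
move=> p0 e0 c0; have q0 : 0 < e / (c + 1) by rewrite divr_gt0// ltr_wpDl.
exists ((e / (c + 1)) `^ p^-1); first exact: powR_gt0.
move=> d d0 /(le_powRl (ltW p0) d0).
rewrite -powRrM mulVf ?gt_eqF// powRr1 ?(ltW q0)// => H.
apply: (@le_trans _ _ (c * (e / (c + 1)))); first by rewrite ler_wpM2l.
rewrite mulrCA ler_piMr ?(ltW e0)// ler_pdivrMr ?ltr_wpDl//; lra.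
Qed.

(** Write [x] as the product of its powers with exponents [b / a] and [1 - b / a], and use one upper
    bound for each factor. *)
Lemma interpolate_powR c d e x a b : 0 < b < a -> 0 <= d -> 0 <= c -> 0 <= e ->
  0 <= x -> x <= c * d `^ a -> x <= e ->
  x <= c `^ (b / a) * e `^ (1 - b / a) * d `^ b.
Proof.
move=> /andP[b0 ba] d0 c0 e0 x0 H1 H2.
have a0 : 0 < a by exact: lt_trans ba.
have q0 : 0 < b / a by rewrite divr_gt0.
have q1 : 0 < 1 - b / a by rewrite subr_gt0 ltr_pdivrMr ?mul1r.
rewrite -[leLHS]powRr1// -[X in x `^ X](subrK (b / a)) powRD; last first.
  by rewrite subrK oner_eq0.
rewrite mulrAC mulrC; apply: ler_pM; rewrite ?powR_ge0//; last exact: le_powRl (ltW q1) _ _.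
apply: le_trans (le_powRl (ltW q0) x0 H1) _.
by rewrite powRM ?powR_ge0// -powRrM mulrCA mulfV ?gt_eqF// mulr1.
Qed.

End Powers.

Section HolderNorm.
Variables (R : realType) (T : R).
Implicit Types F G : R -> R -> R.

Lemma holder_norm_le (g C : R) F :
  (forall s t, s \in `[0, T] -> t \in `[0, T] -> s != t ->
     `|F s t| <= C * `|t - s| `^ g) -> (holder_norm T g F <= C%:E)%E.
Proof.
move=> H; apply: ge_ereal_sup => _ [[s t]/= [sT tT st] <-].
by rewrite lee_fin ler_pdivrMr ?H// powR_gt0// normr_gt0 subr_eq0 eq_sym.
Qed.

Lemma le_holder_norm (g C : R) F : (holder_norm T g F <= C%:E)%E ->
  forall s t, s \in `[0, T] -> t \in `[0, T] -> s != t ->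
     `|F s t| <= C * `|t - s| `^ g.
Proof.
move=> H s t sT tT st; rewrite -ler_pdivrMr; last first.
  by rewrite powR_gt0// normr_gt0 subr_eq0 eq_sym.
by rewrite -lee_fin; apply: le_trans H; apply: ereal_sup_ubound; exists (s, t).
Qed.

Lemma holder_norm_fin (g : R) F : (holder_norm T g F < +oo)%E ->
  exists2 C, 0 <= C & (holder_norm T g F <= C%:E)%E.
Proof.
case: (holder_norm T g F) => [r _||]//; last by exists 0 => //; exact: leNye.
by exists (Num.max r 0); rewrite ?lee_fin le_max lexx ?orbT.
Qed.

(** Positivity of [T] makes the supremum range over a nonempty set; the empty supremum would be
    minus infinity. *)
Lemma holder_norm_ge0 (g : R) F : 0 < T -> (0 <= holder_norm T g F)%E.
Proof.
move=> T0; apply: (@le_trans _ _ (`|F 0 T| / `|T - 0| `^ g)%:E).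
  by rewrite lee_fin divr_ge0// powR_ge0.
apply: ereal_sup_ubound; exists (0, T) => //=.
by split; rewrite ?in_itv/= ?lexx ?(ltW T0)// lt_eqF.
Qed.

Lemma holder_normD (g : R) F G : 0 < T ->
  (holder_norm T g (fun s t => F s t + G s t)%R <= holder_norm T g F + holder_norm T g G)%E.
Proof.
move=> T0; apply: ge_ereal_sup => _ [[s t]/= [sT tT st] <-].
apply: (@le_trans _ _ ((`|F s t| / `|t - s| `^ g)%:E + (`|G s t| / `|t - s| `^ g)%:E)%E).
  by rewrite -EFinD lee_fin -mulrDl ler_wpM2r ?invr_ge0 ?powR_ge0// ler_normD.
by apply: leeD; apply: ereal_sup_ubound; exists (s, t).
Qed.

End HolderNorm.

(** * Weighted bounds for transports and remainders *)

Section Flow.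
Variables (R : realType) (A : finType) (n : nat) (alpha T K : R).
Hypothesis alpha0 : 0 < alpha.
Hypothesis alpha1 : n.+1%:R * alpha <= 1.
Hypothesis K0 : 0 <= K.
Implicit Types (h k : forest A) (z w : forest A -> R) (Z : R -> forest A -> R).

Let M : R := (trans_card A n)%:R.
Let M0 : 0 <= M. Proof. exact: ler0n. Qed.

(** With [n.+1] standing for the level N, this is the scale in which the remainder of index [h] is
    measured. *)
Definition weight (g d : R) h : R := d `^ ((n.+1 - fsize h)%N%:R * g).

Definition wbound (C d : R) z : Prop :=
  forall h, Fle n h -> `|z h| <= C * weight alpha d h.

Lemma weight_exp_ge0 (g : R) h : 0 <= g -> 0 <= (n.+1 - fsize h)%N%:R * g.
Proof. by move=> g0; rewrite mulr_ge0. Qed.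

Lemma weight_exp_le1 h : (n.+1 - fsize h)%N%:R * alpha <= 1.
Proof.
by apply: le_trans alpha1; rewrite ler_wpM2r ?(ltW alpha0)// ler_nat leq_subr.
Qed.

Lemma weight_exp_ge h : Fle n h -> alpha <= (n.+1 - fsize h)%N%:R * alpha.
Proof. by move=> hn; rewrite ler_peMl ?(ltW alpha0)// ler1n subn_gt0 ltnS. Qed.

Lemma wbound_le C D d e z : 0 <= C -> C <= D -> 0 <= d -> d <= e ->
  wbound C d z -> wbound D e z.
Proof.
move=> C0 CD d0 de H h hn; apply: le_trans (H h hn) _.
by apply: ler_pM => //; [exact: powR_ge0|apply: le_powRl => //; apply: weight_exp_ge0; exact: ltW].
Qed.

Lemma wboundD C D d z w : wbound C d z -> wbound D d w -> wbound (C + D) d (z \+ w).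
Proof.
move=> Hz Hw h hn; rewrite mulrDl; apply: le_trans (ler_normD _ _) _.
by apply: lerD; [exact: Hz|exact: Hw].
Qed.

Definition growth (d : R) (phi : forest A -> R) : Prop :=
  forall h, Fle n h -> `|phi h| <= K * d `^ (alpha * (fsize h)%:R).

Lemma growth_le d e phi : 0 <= d -> d <= e -> growth d phi -> growth e phi.
Proof.
move=> d0 de H h hn; apply: le_trans (H h hn) _; rewrite ler_wpM2l//.
by apply: le_powRl => //; rewrite mulr_ge0 // ltW.
Qed.

(** Transport preserves the weights: a term with factors [p.1] and [h] of [k] has exponent
    [alpha * |p.1| + (n + 1 - |k|) * alpha], which equals [(n + 1 - |h|) * alpha] by the grading. *)
Lemma trans_wbound C d phi z : 0 <= C -> 0 < d -> growth d phi -> wbound C d z ->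
  wbound (M * (K * C)) d (trans n phi z).
Proof.
move=> C0 d0 Hphi Hz h hn; rewrite -mulrA; apply: le_trans_card => [|k p kn pk ph].
  by rewrite !mulr_ge0 ?powR_ge0.
have sz := fsize_coprod pk; have kn' : (fsize k <= n)%N by [].
have pn : Fle n p.1 by rewrite /Fle/= (leq_trans _ kn)// -sz leq_addr.
rewrite normrM; apply: le_trans (ler_pM _ _ (Hphi _ pn) (Hz _ kn)) _ => //.
rewrite mulrACA ler_wpM2l ?mulr_ge0// /weight -powRD; last by rewrite (gt_eqF d0) implybT.
rewrite [alpha * _]mulrC -mulrDl -natrD -ph -sz; rewrite le_eqVlt; apply/predU1P; left; congr (_ `^ (_%:R * _)).
by move: kn; rewrite /Fle/= -sz; move: (fsize p.1) (fsize p.2) => a b; clear; lia.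
Qed.

Lemma eq_trans_Fle phi z w : (forall h, Fle n h -> z h = w h) -> trans n phi z = trans n phi w.
Proof. by move=> zw; apply/funext => h; apply: eq_fsbigr => k /set_mem kn; rewrite zw. Qed.

Variable X : R -> R -> forest A -> R.
Hypothesis XK : forall s t, s \in `[0, T] -> t \in `[0, T] -> growth `|t - s| (X s t).
Hypothesis Xdiag : forall s, s \in `[0, T] -> X s s = counit R (A := A).
Hypothesis Xchen : forall s u t, s \in `[0, T] -> u \in `[0, T] -> t \in `[0, T] ->
  star (X s u) (X u t) = X s t.

Definition flow_rem (Y : R -> R -> forest A -> R) Z s t := Z t \- trans n (Y s t) (Z s).

Lemma flow_rem_comp Z s u t : s \in `[0, T] -> u \in `[0, T] -> t \in `[0, T] ->
  flow_rem X Z s t = flow_rem X Z u t \+ trans n (X u t) (flow_rem X Z s u).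
Proof.
move=> sT uT tT; rewrite /flow_rem transB trans_comp Xchen//.
by apply/funext => h /=; rewrite addrA subrK.
Qed.

Lemma flow_rem_refl Z s h : s \in `[0, T] -> Fle n h -> flow_rem X Z s s h = 0.
Proof. by move=> sT hn; rewrite /flow_rem/= Xdiag// trans_counit// subrr. Qed.

Lemma flow_rem_comp_wbound Z C D d s u t : 0 <= C -> 0 < d ->
  s \in `[0, T] -> u \in `[0, T] -> t \in `[0, T] -> `|t - u| <= d ->
  wbound C d (flow_rem X Z s u) -> wbound D d (flow_rem X Z u t) ->
  wbound (D + M * (K * C)) d (flow_rem X Z s t).
Proof.
move=> C0 d0 sT uT tT tud HC HD; rewrite (flow_rem_comp _ sT uT tT).
apply: wboundD => //; apply: trans_wbound => //.
by apply: growth_le tud _ => //; exact: XK.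
Qed.

(** Going from [s] to [t] and back has zero remainder, so the backward remainder is minus the
    transported forward one. *)
Lemma flow_rem_swap_wbound Z C d s t : 0 <= C -> 0 < d ->
  s \in `[0, T] -> t \in `[0, T] -> `|t - s| <= d ->
  wbound C d (flow_rem X Z s t) -> wbound (M * (K * C)) d (flow_rem X Z t s).
Proof.
move=> C0 d0 sT tT tsd HC h hn.
have := congr1 (@^~ h) (flow_rem_comp Z sT tT sT); rewrite /= flow_rem_refl//.
move=> /esym/eqP; rewrite addr_eq0 => /eqP ->; rewrite normrN.
by apply: trans_wbound => //; apply: growth_le tsd _ => //; rewrite distrC; exact: XK.
Qed.

End Flow.

(** * The interpolating path *)

Section Interpolant.
Variables (R : realType) (A : finType) (n : nat) (alpha T K : R).
Hypothesis alpha0 : 0 < alpha.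
Hypothesis alpha1 : n.+1%:R * alpha <= 1.
Hypothesis K0 : 0 <= K.
Hypothesis T0 : 0 < T.
Implicit Types (h k : forest A).

Let M : R := (trans_card A n)%:R.
Let M0 : 0 <= M. Proof. exact: ler0n. Qed.

Variable X : R -> R -> forest A -> R.
Hypothesis XK : forall s t, s \in `[0, T] -> t \in `[0, T] ->
  growth n alpha K `|t - s| (X s t).
Hypothesis Xdiag : forall s, s \in `[0, T] -> X s s = counit R (A := A).
Hypothesis Xchen : forall s u t, s \in `[0, T] -> u \in `[0, T] -> t \in `[0, T] ->
  star (X s u) (X u t) = X s t.

Variables (theta : R -> R) (L : R).
Hypothesis L0 : 0 <= L.
Hypothesis theta0 : forall x, x <= 0 -> theta x = 0.
Hypothesis theta1 : forall x, 1 <= x -> theta x = 1.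
Hypothesis thetaL : forall x y, `|theta x - theta y| <= L * `|x - y|.

Variables (Z : R -> forest A -> R) (m : nat) (C : R).
Hypothesis m0 : (0 < m)%N.
Hypothesis C0 : 0 <= C.

Let delta : R := T / m%:R.

Let delta_gt0 : 0 < delta. Proof. by rewrite divr_gt0// ltr0n. Qed.

Definition grid (i : nat) : R := i%:R * (T / m%:R).

(** Asked at distinct grid points only: these are at least one mesh apart, so a perturbation of the
    rough path that is small compared with the mesh does not spoil the bound. *)
Hypothesis gridC : forall i j, (i < j <= m)%N ->
  wbound n alpha C (grid j - grid i) (flow_rem n X Z (grid i) (grid j)).

Let Fl i t : forest A -> R := trans n (X (grid i) t) (Z (grid i)).

(* Abel-summed form of the sum over the partition of unity: on the cell
   [grid j, grid j.+1] only the j-th value of theta is strictly between 0 and 1,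
   the earlier ones being 1 and the later ones 0, so the sum telescopes. *)
Definition interpolant (t : R) : forest A -> R := fun h =>
  trans n (X (grid 0) t) (Z (grid 0)) h +
  \sum_(i < m) theta (t / (T / m%:R) - i%:R) *
    (trans n (X (grid i.+1) t) (Z (grid i.+1)) h -
     trans n (X (grid i) t) (Z (grid i)) h).

Lemma grid_le i j : (i <= j)%N -> grid i <= grid j.
Proof. by move=> ij; rewrite ler_pM2r// ler_nat. Qed.

Lemma gridS i : grid i.+1 = grid i + delta.
Proof. by rewrite /grid -natr1 mulrDl mul1r. Qed.

Lemma grid_last : grid m = T.
Proof. by rewrite /grid mulrC divfK// pnatr_eq0 -lt0n. Qed.

Lemma grid_in i : (i <= m)%N -> grid i \in `[0, T].
Proof.
move=> im; rewrite in_itv/= mulr_ge0 ?(ltW delta_gt0)//=.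
by rewrite /grid mulrCA ler_piMr ?(ltW T0)// ler_pdivrMr ?ltr0n// mul1r ler_nat.
Qed.

Lemma grid_cell t : t \in `[0, T] ->
  exists2 j, (j < m)%N & grid j <= t <= grid j.+1.
Proof.
rewrite in_itv/= => /andP[t0 tT].
have y0 : 0 <= t / delta by rewrite divr_ge0// ltW.
have /andP[] := truncn_itv y0; rewrite ler_pdivlMr// ltr_pdivrMr//.
rewrite -[_%:R * delta]/(grid _) -[_.+1%:R * delta]/(grid _) => H1 H2.
have [jm|] := ltnP (Num.truncn (t / delta)) m.
  by exists (Num.truncn (t / delta)) => //; rewrite H1 ltW.
(* The right end [t = T] would get the cell index [m]; it is assigned to the last cell instead. *)
move=> mj; exists m.-1; rewrite prednK//.
have tE : t = T.
  by apply/le_anti; rewrite tT/= (le_trans _ H1)// -grid_last grid_le.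
have := grid_in (leq_pred m).
by rewrite tE grid_last in_itv/= lexx => /andP[_ ->].
Qed.

Lemma interpolant_cell j t h : (j < m)%N -> grid j <= t <= grid j.+1 ->
  interpolant t h = Fl j t h + theta (t / delta - j%:R) * (Fl j.+1 t h - Fl j t h).
Proof.
move=> jm /andP[t1 t2].
have x1 : j%:R <= t / delta by rewrite ler_pdivlMr.
have x2 : t / delta <= j.+1%:R by rewrite ler_pdivrMr.
rewrite /interpolant -(big_mkord xpredT (fun i => theta (t / (T / m%:R) - i%:R) *
    (Fl i.+1 t h - Fl i t h))) (big_cat_nat (n := j)) ?(ltnW jm)//=.
rewrite (big_ltn jm) [X in _ + (_ + (_ + X))]big1_seq ?addr0; last first.
  move=> i /=; rewrite mem_index_iota => /andP[ji im]; rewrite theta0 ?mul0r//.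
  by rewrite subr_le0 (le_trans x2)// ler_nat.
rewrite (eq_big_nat _ _ (F2 := fun i => Fl i.+1 t h - Fl i t h)); last first.
  move=> i /andP[_ ij]; rewrite theta1 ?mul1r// lerBrDr (le_trans _ x1)//.
  by rewrite -[1]/1%:R -natrD add1n ler_nat.
by rewrite (telescope_sumr (fun i => Fl i t h))// addrA; congr +%R; rewrite addrC subrK.
Qed.

Lemma interpolant_grid i h : (i <= m)%N -> Fle n h -> interpolant (grid i) h = Z (grid i) h.
Proof.
move=> im hn.
have FlE : Fl i (grid i) h = Z (grid i) h.
  by rewrite /Fl Xdiag ?grid_in// trans_counit.
have gE : grid i / delta = i%:R by rewrite /grid mulfK// gt_eqF.
move: im; rewrite leq_eqVlt => /predU1P[im|im].
  (* The last grid point opens no cell; it is read off as the right end of the previous one, where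
     [theta] is 1. *)
  subst i; rewrite (@interpolant_cell m.-1) ?prednK//; last first.
    by rewrite lexx grid_le ?leq_pred.
  rewrite gE theta1 ?mul1r; first by rewrite addrC subrK.
  by rewrite -{1}(prednK m0) -natr1 addrAC subrr add0r.
rewrite (@interpolant_cell i)//; last by rewrite lexx grid_le.
by rewrite gE subrr theta0// mul0r addr0.
Qed.

(** By Chen's relation each [Fl i] is carried along exactly by the transport, so only the increment
    of [theta] survives. It multiplies [Fl j.+1 t - Fl j t], the transported remainder across the
    cell. *)
Lemma flow_rem_interpolant_cell j s t : (j < m)%N -> s \in `[0, T] -> t \in `[0, T] ->
  grid j <= s <= grid j.+1 -> grid j <= t <= grid j.+1 ->
  flow_rem n X interpolant s t =
  (theta (t / delta - j%:R) - theta (s / delta - j%:R)) \*o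
    trans n (X (grid j.+1) t) (flow_rem n X Z (grid j) (grid j.+1)).
Proof.
move=> jm sT tT sj tj.
have jT := grid_in (ltnW jm); have jT' := grid_in jm.
(* Substituting the cell formula for the whole path makes it available inside the transport, where
   all coefficients at time [s] enter at once. *)
have -> : interpolant = fun u => if u \in `[grid j, grid j.+1] then
    (Fl j u \+ (theta (u / delta - j%:R) \*o (Fl j.+1 u \- Fl j u))) else interpolant u.
  apply/funext => u; case: ifPn => //; rewrite in_itv/= => uj.
  by apply/funext => h; exact: interpolant_cell.
rewrite /flow_rem !in_itv/= sj tj.
have addE (z w : forest A -> R) : z \+ w = z \- ((-1) \*o w).
  by apply/funext => h /=; rewrite mulN1r opprK.
rewrite addE [X in _ \- trans _ _ X]addE !transB !transZ !transB.
rewrite /Fl !trans_comp !Xchen//.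
by apply/funext => h /=; ring.
Qed.

Let C2 : R := L * (M * (K * C)).
Let C2_ge0 : 0 <= C2. Proof. by rewrite !mulr_ge0. Qed.

(** The increment of [theta] is at most [L] times the ratio of [|t - s|] to [delta]. This ratio is
    at most 1 and the weight exponents are at most 1, so the ratio may be raised to the weight
    exponent; this turns the power of [delta] into one of [|t - s|]. *)
Lemma flow_rem_interpolant_cell_wbound j s t : (j < m)%N -> s \in `[0, T] -> t \in `[0, T] ->
  grid j <= s <= grid j.+1 -> grid j <= t <= grid j.+1 ->
  wbound n alpha C2 `|t - s| (flow_rem n X interpolant s t).
Proof.
move=> jm sT tT sj tj h hn; rewrite (flow_rem_interpolant_cell jm)//=.
have [->|st] := eqVneq s t; first by rewrite subrr mul0r normr0 mulr_ge0 ?powR_ge0.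
have d0 : 0 < `|t - s| by rewrite normr_gt0 subr_eq0 eq_sym.
have jT' := grid_in jm.
have dd : `|t - s| <= delta.
  by rewrite ler_norml; move: sj tj; rewrite gridS => /andP[? ?] /andP[? ?]; lra.
have td : `|t - grid j.+1| <= delta.
  by rewrite ler_norml; move: tj; rewrite gridS => /andP[? ?]; lra.
have H : wbound n alpha (M * (K * C)) delta
    (trans n (X (grid j.+1) t) (flow_rem n X Z (grid j) (grid j.+1))).
  apply: trans_wbound => //.
    by apply: growth_le td _ => //; exact: XK.
  have := @gridC j j.+1; rewrite ltnSn jm gridS addrC addKr; exact.
rewrite normrM.
have -> : C2 * weight n alpha `|t - s| h = (L * (`|t - s| / delta) `^ ((n.+1 - fsize h)%N%:R * alpha))
     * (M * (K * C) * weight n alpha delta h).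
  rewrite /weight -[in LHS](divfK (lt0r_neq0 delta_gt0) `|t - s|).
  by rewrite powRM ?(divr_ge0 (normr_ge0 _)) ?(ltW delta_gt0)// /C2; ring.
apply: ler_pM => //; last exact: H.
apply: le_trans (thetaL _ _) _; rewrite ler_wpM2l//.
have -> : t / delta - j%:R - (s / delta - j%:R) = (t - s) / delta by ring.
rewrite normrM normfV (gtr0_norm delta_gt0).
have q1 : 0 < `|t - s| / delta <= 1 by rewrite divr_gt0//= ler_pdivrMr// mul1r.
rewrite -[leLHS]powRr1; last by case/andP: q1 => /ltW.
apply: ger_powR => //; exact: weight_exp_le1.
Qed.

(** Free of the mesh. [C2] serves inside one cell and [C4] for arbitrary [s < t], by two
    compositions at grid points; the last line adds the cost of reversing time. *)
Definition interpolant_cst : R :=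
  let C2 := L * (M * (K * C)) in
  let C4 := C2 + M * (K * (C + M * (K * C2))) in
  C4 + M * (K * C4).

Let C3 : R := C + M * (K * C2).
Let C3_ge0 : 0 <= C3. Proof. by rewrite addr_ge0// !mulr_ge0. Qed.
Let C4 : R := C2 + M * (K * C3).
Let C4_ge0 : 0 <= C4. Proof. by rewrite addr_ge0// !mulr_ge0. Qed.

Lemma interpolant_cst_ge0 : 0 <= interpolant_cst.
Proof. by rewrite /interpolant_cst -/C2 -/C3 -/C4 addr_ge0// !mulr_ge0. Qed.

(** If [s] and [t] lie in different cells, the interval is cut at the first grid point after [s] and
    the last one before [t]. The outer pieces stay in one cell, and the middle one joins grid
    points, where the interpolant is [Z]. *)
Let flow_rem_interpolant_lt s t : s \in `[0, T] -> t \in `[0, T] -> s < t ->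
  wbound n alpha C4 (t - s) (flow_rem n X interpolant s t).
Proof.
move=> sT tT st; have d0 : 0 < t - s by rewrite subr_gt0.
have [i im si] := grid_cell sT; have [j jm tj] := grid_cell tT.
have ile : (i <= j)%N.
  rewrite leqNgt; apply/negP => ji; move: si tj => /andP[si _] /andP[_ tj].
  by have := le_lt_trans si (lt_le_trans st (le_trans tj (grid_le ji))); rewrite ltxx.
move: ile; rewrite leq_eqVlt => /predU1P[ij|ij].
  have := flow_rem_interpolant_cell_wbound im sT tT si; rewrite ij => /(_ tj).
  rewrite (gtr0_norm d0); apply: wbound_le => //; rewrite ?(ltW d0)//.
  by rewrite lerDl !mulr_ge0.
have uT := grid_in im; have vT := grid_in (ltnW jm).
have uv : grid i.+1 <= grid j by exact: grid_le.
move: (si) (tj) => /andP[si1 si2] /andP[tj1 tj2].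
have Hsv : wbound n alpha C3 (t - s) (flow_rem n X interpolant s (grid j)).
  apply: (flow_rem_comp_wbound alpha0 K0 XK Xchen (u := grid i.+1)) => //.
  - by rewrite ler_norml; lra.
  - have := @flow_rem_interpolant_cell_wbound i s (grid i.+1) im sT uT si.
    rewrite lexx grid_le// => /(_ isT); apply: wbound_le => //; rewrite ler_norml; lra.
  (* For neighbouring cells the middle piece is degenerate and its remainder vanishes; [gridC]
     speaks of distinct grid points only. *)
  - have [->|uj] := eqVneq i.+1 j.
      by move=> h hn; rewrite (flow_rem_refl Xdiag)// normr0 mulr_ge0 ?powR_ge0.
    have uj' : (i.+1 < j)%N by rewrite ltn_neqAle uj.
    move=> h hn; rewrite /flow_rem/= interpolant_grid ?(ltnW jm)//.
    rewrite (eq_trans_Fle _ (w := Z (grid i.+1))); last first.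
      by move=> k kn; rewrite interpolant_grid.
    have := @gridC i.+1 j; rewrite uj' (ltnW jm) => /(_ isT).
    move=> /(wbound_le alpha0 C0 (lexx C) _ _); apply => //; lra.
apply: (flow_rem_comp_wbound alpha0 K0 XK Xchen (u := grid j)) => //; last 1 first.
- have := @flow_rem_interpolant_cell_wbound j (grid j) t jm vT tT.
  rewrite lexx grid_le// => /(_ isT tj); apply: wbound_le => //; rewrite ler_norml; lra.
- by rewrite ler_norml; lra.
Qed.

Lemma flow_rem_interpolant_wbound s t : s \in `[0, T] -> t \in `[0, T] -> s != t ->
  wbound n alpha interpolant_cst `|t - s| (flow_rem n X interpolant s t).
Proof.
move=> sT tT; rewrite neq_lt => /orP[st|ts].
- have d0 : 0 < t - s by rewrite subr_gt0.
  rewrite gtr0_norm//; have := flow_rem_interpolant_lt sT tT st.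
  by apply: wbound_le => //; rewrite ?(ltW d0)// lerDl !mulr_ge0.
- have d0 : 0 < s - t by rewrite subr_gt0.
  rewrite distrC gtr0_norm//; have := flow_rem_interpolant_lt tT sT ts.
  have d1 : `|s - t| <= s - t by rewrite gtr0_norm.
  move=> /(flow_rem_swap_wbound alpha0 K0 XK Xdiag Xchen C4_ge0 d0 tT sT d1).
  apply: wbound_le => //; [by rewrite !mulr_ge0|by rewrite lerDr|exact: ltW].
Qed.

Lemma smooth_on_interpolant h : smooth theta ->
  (forall s k, s \in `[0, T] -> smooth_on T (fun t => X s t k)) ->
  smooth_on T (interpolant ^~ h).
Proof.
move=> stheta sX.
have sFl i : (i <= m)%N -> smooth_on T (fun t => Fl i t h).
  move=> im; rewrite /Fl /trans.
  under eq_fun do rewrite (fsbig_finite _ _ (finite_Fle A n))/=.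
  apply: smooth_on_sum => k _; apply: smooth_onM; last exact/smooth_on_smooth/smooth_cst.
  rewrite /star; apply: smooth_on_sum => p _.
  by apply: smooth_onM; [exact/sX/grid_in|exact/smooth_on_smooth/smooth_cst].
apply: smooth_onD; first exact: (sFl 0%N).
apply: smooth_on_sum => i _; apply: smooth_onM.
  apply: smooth_on_smooth.
  rewrite (_ : (fun t => _) = fun t => theta ((T / m%:R)^-1 * t + - i%:R)).
    exact: smooth_affine.
  by apply/funext => t; rewrite [t / _]mulrC.
have sN := smooth_onM (smooth_on_smooth T (@smooth_cst R (-1))) (sFl i (ltnW (ltn_ord i))).
apply: eq_smooth_on (smooth_onD (sFl i.+1 (ltn_ord i)) sN).
by move=> t _ /=; rewrite mulN1r.
Qed.

End Interpolant.

(** * Finite sums over truncated forests *)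

Section FiniteSums.
Variables (R : realType) (A : finType) (n : nat).

Definition Fle_card : nat := (\sum_(h \in @Fle A n) 1)%N.

Lemma fle_sum_le (F : forest A -> \bar R) (c : R) :
  (forall h, Fle n h -> (F h <= c%:E)%E) ->
  (\sum_(h \in Fle n) F h <= (Fle_card%:R * c)%:E)%E.
Proof.
move=> H; apply: (@le_trans _ _ (\sum_(h \in @Fle A n) c%:E)%E).
  by apply: lee_fsum; [exact: finite_Fle|exact: H].
rewrite /Fle_card !(fsbig_finite _ _ (finite_Fle A n))/=.
by rewrite sumEFin natr_sum big_distrl/= lee_fin; apply: ler_sum => h _; rewrite mul1r.
Qed.

Lemma fle_term_le (F : forest A -> \bar R) h : (forall k, (0 <= F k)%E) ->
  Fle n h -> (F h <= \sum_(k \in Fle n) F k)%E.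
Proof.
move=> F0 hn; rewrite (fsbigD1 h)//=; last exact: finite_Fle.
by rewrite leeDl// fsume_ge0.
Qed.

Lemma fle_bound (f : forest A -> R) : exists2 C, 0 <= C & forall h, Fle n h -> f h <= C.
Proof.
exists (\sum_(h \in @Fle A n) `|f h|).
  by rewrite (fsbig_finite _ _ (finite_Fle A n))/= sumr_ge0.
move=> h hn; rewrite (fsbigD1 h)//=; last exact: finite_Fle.
rewrite (le_trans (ler_norm _))// lerDl fsbig_finite/= ?sumr_ge0//.
by apply: sub_finite_set (finite_Fle A n) => k [].
Qed.

End FiniteSums.

(** * Translation between norms and pointwise bounds *)

Section ControlledNorms.
Variables (R : realType) (A : finType) (T alpha : R) (n : nat).
Hypothesis T0 : 0 < T.
Hypothesis alpha0 : 0 < alpha.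
Hypothesis levelE : level alpha = n.+1.
Implicit Types (X Y : R -> R -> forest A -> R) (Z W : R -> forest A -> R).

Lemma level_mul_le1 : n.+1%:R * alpha <= 1.
Proof.
by rewrite -levelE -ler_pdivlMr// div1r truncn_le invr_ge0 ltW.
Qed.

Lemma remainderE X Z h s t : remainder alpha X Z h s t = flow_rem n X Z s t h.
Proof. by rewrite /remainder levelE. Qed.

Lemma flow_remB X Z W s t h :
  flow_rem n X (fun t h => Z t h - W t h) s t h = flow_rem n X Z s t h - flow_rem n X W s t h.
Proof. by rewrite /flow_rem/= (transB _ _ (Z s) (W s))/=; ring. Qed.

Lemma cnorm_leP g X Z (c : R) :
  (forall h, Fle n h -> `|Z 0 h| <= c) ->
  (forall h s t, Fle n h -> s \in `[0, T] -> t \in `[0, T] -> s != t ->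
    `|flow_rem n X Z s t h| <= c * weight n g `|t - s| h) ->
  (cnorm T alpha g X Z <= ((Fle_card A n)%:R * (c + c))%:E)%E.
Proof.
move=> H0 H; rewrite /cnorm levelE; apply: fle_sum_le => h hn.
rewrite EFinD; apply: leeD; first by rewrite lee_fin H0.
by apply: holder_norm_le => s t sT tT st; rewrite remainderE; exact: H.
Qed.

Lemma cdist_leP g X Y Z W (c : R) :
  (forall h, Fle n h -> Z 0 h = W 0 h) ->
  (forall h s t, Fle n h -> s \in `[0, T] -> t \in `[0, T] -> s != t ->
    `|flow_rem n X Z s t h - flow_rem n Y W s t h| <= c * weight n g `|t - s| h) ->
  (cdist T alpha g X Y Z W <= ((Fle_card A n)%:R * c)%:E)%E.
Proof.
move=> H0 H; rewrite /cdist levelE; apply: fle_sum_le => h hn.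
rewrite H0// subrr normr0 add0e.
by apply: holder_norm_le => s t sT tT st; rewrite !remainderE; exact: H.
Qed.

Lemma cdist_ge0 g X Y Z W : (0 <= cdist T alpha g X Y Z W)%E.
Proof.
by apply: fsume_ge0 => h _; apply: adde_ge0; [rewrite lee_fin|exact: holder_norm_ge0].
Qed.

Lemma cdist_triangle g X Y Z W V :
  (cdist T alpha g X Y Z V <=
   cnorm T alpha g X (fun t h => Z t h - W t h)%R + cdist T alpha g X Y W V)%E.
Proof.
rewrite /cdist /cnorm levelE !(fsbig_finite _ _ (finite_Fle A n))/= -big_split/=.
apply: lee_sum => h _; rewrite addeACA; apply: leeD.
  rewrite -EFinD lee_fin -(subrKA (W 0 h)); exact: ler_normD.
apply: le_trans (holder_normD _ _ _ T0).
rewrite le_eqVlt; apply/predU1P; left; congr holder_norm.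
by apply/funext => s; apply/funext => t; rewrite !remainderE flow_remB subrKA.
Qed.

Lemma controlled_wbound X Z : controlled T alpha X Z ->
  exists2 C, 0 <= C & forall s t, s \in `[0, T] -> t \in `[0, T] -> s != t ->
    wbound n alpha C `|t - s| (flow_rem n X Z s t).
Proof.
case=> _; rewrite /cnorm levelE/= => Hfin.
have /choice[c Hc] : forall h, exists c, Fle n h -> 0 <= c /\
  (holder_norm T ((n.+1 - fsize h)%N%:R * alpha) (remainder alpha X Z h) <= c%:E)%E.
  move=> h; have [hn|hn] := pselect (Fle n h); last by exists 0.
  have [|c c0 Hc] := @holder_norm_fin _ T ((n.+1 - fsize h)%N%:R * alpha) (remainder alpha X Z h).
    apply: le_lt_trans Hfin.
    apply: le_trans (fle_term_le (F := fun h => (`|Z 0 h|%:E +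
      holder_norm T ((n.+1 - fsize h)%N%:R * alpha) (remainder alpha X Z h))%E) _ hn) => [|k].
      by rewrite leeDr// lee_fin.
    by apply: adde_ge0; [rewrite lee_fin|exact: holder_norm_ge0].
  by exists c.
have [C C0 HC] := fle_bound n c; exists C => // s t sT tT st h hn.
have [_ /le_holder_norm/(_ s t sT tT st)] := Hc h hn; rewrite remainderE => H.
by apply: le_trans H _; rewrite ler_wpM2r ?powR_ge0// HC.
Qed.

Lemma rough_path_growth X : rough_path T alpha X ->
  exists2 K, 0 <= K & forall s t, s \in `[0, T] -> t \in `[0, T] -> s != t ->
    growth n alpha K `|t - s| (X s t).
Proof.
case=> _ _ Hfin.
have /choice[c Hc] : forall h, exists c, 0 <= c /\
  (holder_norm T (alpha * (fsize h)%:R) (fun s t => X s t h) <= c%:E)%E.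
  by move=> h; have [c c0 Hc] := holder_norm_fin (Hfin h); exists c.
have [C C0 HC] := fle_bound n c; exists C => // s t sT tT st h hn.
have [_ /le_holder_norm/(_ s t sT tT st) H] := Hc h.
by apply: le_trans H _; rewrite ler_wpM2r ?powR_ge0// HC.
Qed.

Lemma norm_sub_le s t : s \in `[0, T] -> t \in `[0, T] -> `|t - s| <= T.
Proof. by rewrite !in_itv/= ler_norml => /andP[? ?] /andP[? ?]; lra. Qed.

Lemma growth_exp01 (h : forest A) : Fle n h -> 0 <= alpha * (fsize h)%:R <= 1.
Proof.
move=> hn; rewrite mulr_ge0 ?(ltW alpha0)//= (le_trans _ level_mul_le1)// mulrC.
by rewrite ler_wpM2r ?(ltW alpha0)// ler_nat (leq_trans hn).
Qed.

Lemma weight_exp01 (h : forest A) : 0 <= (n.+1 - fsize h)%N%:R * alpha <= 1.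
Proof.
by rewrite weight_exp_ge0 ?(ltW alpha0)//= (weight_exp_le1 _ level_mul_le1).
Qed.

Lemma zero_controlled X : controlled T alpha X (fun _ _ => 0).
Proof.
split=> //; apply: (@le_lt_trans _ _ ((Fle_card A n)%:R * (0 + 0))%:E); last exact: ltry.
apply: cnorm_leP => h => [|s t] _; first by rewrite normr0.
move=> _ _ _; rewrite mul0r -[X in flow_rem _ _ X](_ : (fun _ _ => 0 - 0) = _).
  by rewrite (flow_remB _ (fun _ _ => 0)) subrr normr0.
by apply/funext => u; apply/funext => k; rewrite subrr.
Qed.

(** On a bounded interval the surplus power of [|t - s|], with exponent at most 1, is bounded by the
    maximum of 1 and [T]; the path then serves as its own approximation. *)
Lemma controlled_closureW beta X Z : 0 < beta < alpha ->
  controlled T alpha X Z -> controlled_closure T alpha beta X Z.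
Proof.
move=> /andP[b0 ba] XZ; have [C C0 HC] := controlled_wbound XZ.
have [D D0 HD] := fle_bound n (fun h => `|Z 0 h|).
have [spanZ _] := XZ; split => //.
- pose c := D + C * Num.max 1 T.
  have m0 : 0 <= Num.max 1 T by rewrite le_max ler01.
  apply: (@le_lt_trans _ _ ((Fle_card A n)%:R * (c + c))%:E); last exact: ltry.
  apply: cnorm_leP => h => [|s t] hn.
    by apply: le_trans (HD _ hn) _; rewrite lerDl mulr_ge0.
  move=> sT tT st; apply: le_trans (HC s t sT tT st h hn) _.
  have d0 : 0 < `|t - s| by rewrite normr_gt0 subr_eq0 eq_sym.
  rewrite /weight -[alpha](subrK beta) mulrDr powRD; last by rewrite (gt_eqF d0) implybT.
  rewrite mulrA ler_wpM2r ?powR_ge0//.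
  apply: (@le_trans _ _ (C * Num.max 1 T)); last by rewrite lerDr.
  rewrite ler_wpM2l//; apply: powR_le_max1 (norm_sub_le sT tT) => //.
  have ab0 : 0 <= alpha - beta by rewrite subr_ge0 ltW.
  have /andP[_ w1] := weight_exp01 h.
  by rewrite mulr_ge0//= (le_trans _ w1)// ler_wpM2l// gerBl ltW.
- move=> e e0; exists Z => //; apply: (@le_lt_trans _ _ ((Fle_card A n)%:R * (0 + 0))%:E).
    apply: cnorm_leP => h => [|s t] _; first by rewrite subrr normr0.
    by move=> _ _ _; rewrite flow_remB subrr normr0 mul0r.
  by rewrite addr0 mulr0 lte_fin.
Qed.

End ControlledNorms.

(** * Approximation *)

Section Approximation.
Variables (R : realType) (A : finType) (T alpha beta : R) (n : nat).
Hypothesis T0 : 0 < T.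
Hypothesis hbeta : 0 < beta < alpha.
Hypothesis levelE : level alpha = n.+1.

Let beta0 : 0 < beta. Proof. by case/andP: hbeta. Qed.
Let alpha0 : 0 < alpha. Proof. by case/andP: hbeta; exact: lt_trans. Qed.
Let alpha1 : n.+1%:R * alpha <= 1. Proof. exact: level_mul_le1. Qed.
Let M : R := (trans_card A n)%:R.
Let M0 : 0 <= M. Proof. exact: ler0n. Qed.
Let B : R := Num.max 1 T.
Let B1 : 1 <= B. Proof. by rewrite le_max lexx. Qed.
Let B0 : 0 <= B. Proof. exact: le_trans B1. Qed.

(** Each value is the remainder from time 0 plus the transported initial value, and both are bounded
    on [[0, T]]. *)
Lemma controlled_bounded (X : R -> R -> forest A -> R) (W : R -> forest A -> R) :
  rough_path T alpha X -> controlled T alpha X W ->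
  exists2 C, 0 <= C & forall t h, t \in `[0, T] -> Fle n h -> `|W t h| <= C.
Proof.
move=> hX hW; have [K K0 HK] := rough_path_growth n hX.
have [C C0 HC] := controlled_wbound T0 levelE hW.
have [D D0 HD] := fle_bound n (fun h => `|W 0 h|).
have H0T : 0 \in `[0, T] by rewrite in_itv/= lexx ltW.
exists (D + (C * B + M * (K * B * D))).
  by rewrite !addr_ge0// !mulr_ge0.
move=> t h tT hn; have [->|t0] := eqVneq t 0.
  by rewrite (le_trans (HD h hn))// lerDl addr_ge0// !mulr_ge0.
have t0' : 0 != t by rewrite eq_sym.
have -> : W t h = flow_rem n X W 0 t h + trans n (X 0 t) (W 0) h by rewrite /flow_rem/= subrK.
apply: le_trans (ler_normD _ _) _; apply: ler_wpDl => //; apply: lerD.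
  apply: le_trans (HC 0 t H0T tT t0' h hn) _; rewrite ler_wpM2l//.
  by apply: powR_le_max1 (norm_sub_le H0T tT); rewrite // weight_exp01.
apply: le_trans_card => [|k p kn pk ph]; first by rewrite !mulr_ge0.
have pn : Fle n p.1 by rewrite /Fle/= (leq_trans _ kn)// -(fsize_coprod pk) leq_addr.
rewrite normrM; apply: ler_pM => //; last exact: HD.
apply: le_trans (HK 0 t H0T tT t0' p.1 pn) _; rewrite ler_wpM2l//.
by apply: powR_le_max1 (norm_sub_le H0T tT); rewrite // (growth_exp01 alpha0 levelE).
Qed.

(** The metric ranges over nonempty forests; at the empty forest the difference is zero because both
    values are characters. *)
Lemma rho_growth (X Y : R -> R -> forest A -> R) (r : R) : 0 <= r ->
  (rho T alpha X Y <= r%:E)%E ->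
  (forall s t, s \in `[0, T] -> t \in `[0, T] -> character (X s t)) ->
  (forall s t, s \in `[0, T] -> t \in `[0, T] -> character (Y s t)) ->
  forall s t, s \in `[0, T] -> t \in `[0, T] -> s != t ->
    growth n alpha r `|t - s| (X s t \- Y s t).
Proof.
move=> r0 XY cX cY s t sT tT st h hn /=; have [->|h1] := eqVneq h (fone A).
  have [-> _] := cX s t sT tT; have [-> _] := cY s t sT tT.
  by rewrite subrr normr0 mulr_ge0 ?powR_ge0.
rewrite [alpha * _]mulrC; apply: (le_holder_norm (T := T) (F := fun s t => X s t h - Y s t h)) => //.
apply: le_trans XY; apply: ereal_sup_ubound; exists h => //.
split; last exact/eqP.
by rewrite levelE; apply: leq_trans hn _.
Qed.

(** The radius [r] is chosen before [X'], after the mesh: it depends on [X], [W] and [e] alone and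
    so works for all small parameters of the approximating family. *)
Lemma smooth_approx (X : R -> R -> forest A -> R) (W : R -> forest A -> R) (e : R) :
  rough_path T alpha X -> controlled T alpha X W -> 0 < e ->
  exists2 r, 0 < r & forall X', smooth_rough_path T X' ->
    (rho T alpha X' X <= r%:E)%E ->
  exists Y, [/\ controlled T alpha X' Y, forall h, smooth_on T (fun t => Y t h) &
    (cdist T alpha beta X X' W Y <= e%:E)%E].
Proof.
move=> hX hW e0; have [K0 K00 HK0] := rough_path_growth n hX.
have [CW CW0 HCW] := controlled_wbound T0 levelE hW.
have [MW MW0 HMW] := controlled_bounded hX hW.
have [theta [L L0 [stheta theta0 theta1 thetaL]]] := smooth_step R.
(* The summands 1 in [K] and [C1] absorb the difference between [X'] and [X]: in the growth bound
   since [r] is at most 1, in the grid remainders since that error is at most the mesh [d]. *)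
pose K := K0 + 1; have K_ge0 : 0 <= K by rewrite addr_ge0.
pose C1 := CW + 1; have C10 : 0 <= C1 by rewrite addr_ge0.
pose C5 := interpolant_cst A n K L C1.
have C50 : 0 <= C5 by exact: interpolant_cst_ge0.
(* [C6] times the power [alpha] of the mesh will bound the difference of the two remainders
   uniformly in time. *)
pose C6 := (C5 + CW + 1) * (1 + M * (K * B)) + 1.
have S0 : 0 <= C5 + CW + 1 by rewrite addr_ge0// addr_ge0.
have C60 : 0 <= C6 by rewrite addr_ge0// mulr_ge0// addr_ge0// !mulr_ge0.
pose q := beta / alpha.
have q1 : 0 < 1 - q by case/andP: hbeta => _ ba; rewrite subr_gt0 ltr_pdivrMr ?mul1r.
have [||d0 d0_gt0 Hd0] := @powR_small R
    ((Fle_card A n)%:R * ((C5 + CW) `^ q * C6 `^ (1 - q))) e (alpha * (1 - q)) _ e0 _.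
- by rewrite mulr_gt0.
- by rewrite !mulr_ge0 ?powR_ge0.
pose m := (Num.truncn (T / Num.min d0 1)).+1; pose d := T / m%:R.
have md0 : 0 < Num.min d0 1 by rewrite lt_min d0_gt0 ltr01.
have m0 : (0 < m)%N by [].
have d_gt0 : 0 < d by rewrite divr_gt0// ltr0n.
have dmin : d <= Num.min d0 1.
  rewrite ler_pdivrMr ?ltr0n// mulrC -ler_pdivrMr//.
  have /andP[_ /ltW] := truncn_itv (divr_ge0 (ltW T0) (ltW md0)).
  exact.
have [dd0 d1] : d <= d0 /\ d <= 1 by move: dmin; rewrite le_min => /andP[].
(* Chosen so that transporting [W] along [X'] instead of along [X] changes each coefficient by at
   most [d]; the added 1 keeps the denominator positive. *)
pose r := Num.min 1 (d / (M * (B * MW) + 1)).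
have Q0 : 0 <= M * (B * MW) by rewrite !mulr_ge0.
have Q1 : 0 < M * (B * MW) + 1 by rewrite ltr_wpDl.
have r0 : 0 < r by rewrite lt_min ltr01 divr_gt0.
exists r => // X' [x [sx lX']] XX'.
have chX := canonical_lift_chen sx lX'.
have dgX := canonical_lift_diag lX'.
have cX' := lX'.1.
have [cX _ _] := hX.
have HD := rho_growth (ltW r0) XX' cX' cX.
have grow01 (h : forest A) s t : s \in `[0, T] -> t \in `[0, T] -> Fle n h ->
    `|t - s| `^ (alpha * (fsize h)%:R) <= B.
  move=> sT tT hn; apply: powR_le_max1 (norm_sub_le sT tT) => //.
  exact: growth_exp01 levelE _ hn.
have XK s t : s \in `[0, T] -> t \in `[0, T] -> growth n alpha K `|t - s| (X' s t).
  move=> sT tT h hn; have [->|st] := eqVneq s t.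
    (* Hölder norms carry no information on the diagonal. There the lift is the counit, and since
       zero to the power zero is 1 the empty forest requires [K] to be at least 1. *)
    rewrite dgX// subrr normr0 /counit; case: eqP => [->|_]; last first.
      by rewrite normr0 mulr_ge0 ?powR_ge0.
    by rewrite fsize_one mulr0 powRr0 normr1 mulr1 lerDr.
  rewrite -(subrK (X s t h) (X' s t h)) addrC /K mulrDl mul1r.
  apply: le_trans (ler_normD _ _) _; apply: lerD; first exact: HK0.
  apply: le_trans (HD s t sT tT st h hn) _.
  by rewrite ler_piMl ?powR_ge0// ge_min lexx.
have HDW s t h : s \in `[0, T] -> t \in `[0, T] -> s != t -> Fle n h ->
    `|trans n (X' s t \- X s t) (W s) h| <= d.
  move=> sT tT st hn; apply: (@le_trans _ _ (M * (r * B * MW))).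
    apply: le_trans_card => [|k p kn pk ph]; first by rewrite !mulr_ge0 ?(ltW r0).
    have pn : Fle n p.1 by rewrite /Fle/= (leq_trans _ kn)// -(fsize_coprod pk) leq_addr.
    rewrite normrM; apply: ler_pM => //; last exact: HMW.
    by apply: le_trans (HD s t sT tT st p.1 pn) _; rewrite ler_wpM2l ?(ltW r0)// grow01.
  have -> : M * (r * B * MW) = r * (M * (B * MW)) by ring.
  apply: (@le_trans _ _ (d / (M * (B * MW) + 1) * (M * (B * MW)))).
    by rewrite ler_wpM2r// ge_min lexx orbT.
  rewrite mulrAC ler_pdivrMr// ler_wpM2l ?(ltW d_gt0)// lerDl//.
have flowE s t : flow_rem n X' W s t = flow_rem n X W s t \- trans n (X' s t \- X s t) (W s).
  by rewrite trans_subl /flow_rem; apply/funext => h /=; ring.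
have wle1 (h : forest A) : 0 <= (n.+1 - fsize h)%N%:R * alpha <= 1.
  exact: weight_exp01 levelE _.
have dw (h : forest A) : d <= weight n alpha d h.
  by rewrite -[leLHS]powRr1 ?(ltW d_gt0)// ger_powR// ?d_gt0//; case/andP: (wle1 h).
have gridC i j : (i < j <= m)%N ->
    wbound n alpha C1 (grid T m j - grid T m i) (flow_rem n X' W (grid T m i) (grid T m j)).
  move=> /andP[ij jm] h hn.
  (* The error [d] is below the weight at [d], as [d] and the exponent are at most 1, hence below
     the weight at the distance of the grid points. *)
  have dij : d <= grid T m j - grid T m i.
    by rewrite lerBrDl -gridS; exact: grid_le.
  have gij : grid T m i != grid T m j by rewrite lt_eqF// -subr_gt0 (lt_le_trans d_gt0).
  have iT := grid_in T0 m0 (ltnW (leq_trans ij jm)); have jT := grid_in T0 m0 jm.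
  rewrite flowE/= /C1 mulrDl mul1r.
  apply: le_trans (ler_normB _ _) _; apply: lerD.
    have := HCW _ _ iT jT gij h hn.
    by rewrite (ger0_norm (le_trans (ltW d_gt0) dij)).
  apply: le_trans (HDW _ _ h iT jT gij hn) _; apply: le_trans (dw h) _.
  by apply: le_powRl => //; [case/andP: (wle1 h)|exact: ltW].
pose Y := interpolant n T X' theta W m.
have HY s t (sT : s \in `[0, T]) (tT : t \in `[0, T]) (st : s != t) :=
  flow_rem_interpolant_wbound alpha0 alpha1 K_ge0 T0 XK dgX chX L0 theta0 theta1
    thetaL m0 C10 gridC sT tT st.
have Ygrid i h : (i <= m)%N -> Fle n h -> Y (grid T m i) h = W (grid T m i) h.
  by move=> im hn; exact: (interpolant_grid T0 dgX theta0 theta1 W m0 im hn).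
have grid0 : grid T m 0 = 0 by rewrite /grid mul0r.
have Y0 h : Fle n h -> Y 0 h = W 0 h by move=> hn; rewrite -grid0; exact: Ygrid.
have cY : controlled T alpha X' Y.
  split.
    move=> t h tT; rewrite levelE /= => hn; rewrite /Y /interpolant !trans_out// add0r.
    by rewrite big1// => i _; rewrite !trans_out// subrr mulr0.
  have [D D0 HD0] := fle_bound n (fun h => `|Y 0 h|).
  apply: (@le_lt_trans _ _ ((Fle_card A n)%:R * ((D + C5) + (D + C5)))%:E); last exact: ltry.
  apply: cnorm_leP => // h => [|s t] hn.
    by rewrite (le_trans (HD0 h hn))// lerDl.
  move=> sT tT st; apply: le_trans (HY s t sT tT st h hn) _.
  by rewrite ler_wpM2r ?powR_ge0// lerDr.
exists Y; split => //.
  move=> h; apply: (smooth_on_interpolant n T0 W m0 h stheta) => s k sT.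
  exact: (canonical_lift_smooth sx lX' _ sT).
have da : d <= d `^ alpha.
  by rewrite -[leLHS]powRr1 ?(ltW d_gt0)// ger_powR ?d_gt0//; case/andP: (wle1 (fone A)) => _;
    apply: le_trans; rewrite ler_peMl ?(ltW alpha0)// fsize_one subn0 ler1n.
pose E0 := (C5 + CW + 1) * d `^ alpha.
have E00 : 0 <= E0 by rewrite mulr_ge0 ?powR_ge0.
have HE0 t h : t \in `[0, T] -> Fle n h -> `|Y t h - W t h| <= E0.
  move=> tT hn; have [j jm /andP[tj1 tj2]] := grid_cell T0 m0 tT.
  have jT := grid_in T0 m0 (ltnW jm).
  have [tE|tj] := eqVneq (grid T m j) t.
    by rewrite -tE Ygrid ?(ltnW jm)// subrr normr0.
  have wd (C : R) (z : forest A -> R) : 0 <= C -> wbound n alpha C `|t - grid T m j| z ->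
      `|z h| <= C * d `^ alpha.
    move=> C0 /(_ h hn) H; apply: le_trans H _; rewrite ler_wpM2l//.
    apply: (@le_trans _ _ (weight n alpha d h)).
      apply: le_powRl => //; first by case/andP: (wle1 h).
      by rewrite ger0_norm ?subr_ge0// lerBlDl -gridS.
    by rewrite ger_powR ?d_gt0//; exact: weight_exp_ge.
  (* Both paths are restarted from the grid point at the left end of the cell, where they agree; two
     remainders over at most one mesh and the error of exchanging the rough path are left. *)
  have -> : Y t h - W t h = flow_rem n X' Y (grid T m j) t h
      + (- flow_rem n X W (grid T m j) t h)
      + trans n (X' (grid T m j) t \- X (grid T m j) t) (W (grid T m j)) h.
    rewrite trans_subl /flow_rem/= (eq_trans_Fle _ (z := Y _) (w := W (grid T m j))); last first.
      by move=> k kn; rewrite Ygrid ?(ltnW jm).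
    by ring.
  rewrite /E0 mulrDl [(C5 + CW) * _]mulrDl mul1r; apply: le_trans (ler_normD _ _) _; apply: lerD; last first.
    exact: le_trans (HDW _ _ h jT tT tj hn) da.
  apply: le_trans (ler_normD _ _) _; rewrite normrN; apply: lerD.
    by apply: (wd _ (flow_rem n X' Y (grid T m j) t)) => //; exact: HY.
  by apply: (wd _ (flow_rem n X W (grid T m j) t)) => //; exact: HCW.
apply: (@le_trans _ _ ((Fle_card A n)%:R * ((C5 + CW) `^ q * (C6 * d `^ alpha) `^ (1 - q)))%:E).
  apply: cdist_leP => // [h hn|h s t hn sT tT st]; first by rewrite Y0.
  have st0 : 0 < `|t - s| by rewrite normr_gt0 subr_eq0 eq_sym.
  have c0 : 0 < (n.+1 - fsize h)%N%:R :> R by rewrite ltr0n subn_gt0 ltnS.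
  (* The ratio of the two exponents is the same for every forest, so one interpolation constant
     serves all coefficients. *)
  have qE : q = ((n.+1 - fsize h)%N%:R * beta) / ((n.+1 - fsize h)%N%:R * alpha).
    by rewrite -mulf_div divff ?mul1r// gt_eqF.
  rewrite qE; apply: interpolate_powR => //; rewrite -?qE.
  - by rewrite mulr_gt0//= ltr_pM2l//; case/andP: hbeta.
  - by rewrite addr_ge0.
  - by rewrite mulr_ge0 ?powR_ge0.
  - apply: le_trans (ler_normB _ _) _; rewrite addrC mulrDl; apply: lerD.
      exact: HY.
    exact: HCW.
  (* The bound that is uniform in [s] and [t]: each of the three terms is of order [d] to the power
     [alpha]. *)
  - have -> : flow_rem n X W s t h - flow_rem n X' Y s t h =
        - (Y t h - W t h) + (trans n (X' s t) (Y s \- W s) h +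
        trans n (X' s t \- X s t) (W s) h).
      by rewrite transB trans_subl /flow_rem/=; ring.
    have -> : C6 * d `^ alpha = E0 + (M * (K * B * E0) + d `^ alpha).
      by rewrite /C6 /E0; ring.
    apply: le_trans (ler_normD _ _) _; rewrite normrN; apply: lerD; first exact: HE0.
    apply: le_trans (ler_normD _ _) _; apply: lerD.
      apply: le_trans_card => [|k p kn pk ph]; first by rewrite mulr_ge0// mulr_ge0.
      have pn : Fle n p.1 by rewrite /Fle/= (leq_trans _ kn)// -(fsize_coprod pk) leq_addr.
      rewrite normrM; apply: ler_pM => //; last exact: HE0.
      by apply: le_trans (XK s t sT tT p.1 pn) _; rewrite ler_wpM2l// grow01.
    exact: le_trans (HDW _ _ h sT tT st hn) da.
rewrite lee_fin powRM ?powR_ge0// -powRrM !mulrA; rewrite -!mulrA in Hd0 *.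
by have := Hd0 d (ltW d_gt0) dd0; rewrite !mulrA.
Qed.

End Approximation.

(** The approximations obtained so far depend on the desired accuracy, whereas one family is wanted.
    So [Ze eta] is an admissible path whose distance to [Z] exceeds the infimum [I eta] over all
    admissible paths by at most [eta]; it remains to see that [I] tends to 0. *)
Theorem mainTheorem5 (R : realType) (A : finType) (T alpha beta : R)
    (X : R -> R -> forest A -> R) (Xe : R -> R -> R -> forest A -> R)
    (hA : (0 < #|A|)%N) (hT : 0 < T)
    (halpha : 0 < alpha < 1)
    (halphaN : forall n : nat, (0 < n)%N -> alpha != 1 / n%:R)
    (hbeta : 0 < beta < alpha)
    (hX : rough_path T alpha X)
    (hXe : forall eta : R, 0 < eta <= 1 -> smooth_rough_path T (Xe eta))
    (hrho : rho T alpha (Xe eta) X @[eta --> 0^'+] --> 0%E)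
    (Z : R -> forest A -> R)
    (hZ : controlled_closure T alpha beta X Z) :
  exists Ze : R -> R -> forest A -> R,
    (forall eta : R, 0 < eta <= 1 ->
       controlled_closure T alpha beta (Xe eta) (Ze eta) /\
       (forall h : forest A, smooth_on T (fun t => Ze eta t h))) /\
    cdist T alpha beta X (Xe eta) Z (Ze eta) @[eta --> 0^'+] --> 0%E.
Proof.
have /andP[alpha0 alpha1] := halpha.
have levelE : level alpha = (level alpha).-1.+1.
  rewrite prednK// /level lt0n; apply/eqP => l0.
  have i0 : 0 <= alpha^-1 by rewrite invr_ge0 ltW.
  by have /andP[_] := truncn_itv i0; rewrite l0 invf_lt1// ltNge ltW.
pose P eta Y := controlled_closure T alpha beta (Xe eta) Y /\
  (forall h : forest A, smooth_on T (fun t => Y t h)).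
pose cd eta Y := cdist T alpha beta X (Xe eta) Z Y.
have cd0 eta Y : (0 <= cd eta Y)%E by exact: cdist_ge0.
have P0 eta : P eta (fun _ _ => 0).
  split.
    by apply: (controlled_closureW hT alpha0 levelE hbeta); exact: (zero_controlled _ levelE).
  by move=> h; exact/smooth_on_smooth/smooth_cst.
pose I eta := ereal_inf [set cd eta Y | Y in P eta].
have I0 eta : (0 <= I eta)%E by apply: le_ereal_inf_tmp => _ [Y _ <-].
have /choice[Ze HZe] : forall eta, exists Y, 0 < eta -> P eta Y /\ (cd eta Y <= I eta + eta%:E)%E.
  move=> eta; have [eta0|] := ltP 0 eta; last by exists (fun _ _ => 0).
  have [If|] := boolP (I eta \is a fin_num).
    have [_ [Y PY <-] /ltW cY] := lb_ereal_inf_adherent eta0 If.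
    by exists Y.
  (* If the infimum is infinite, the required inequality is void and the zero path, which is always
     admissible, will do. *)
  rewrite ge0_fin_numE// -leNgt leye_eq => /eqP ->.
  by exists (fun _ _ => 0); split => //; rewrite addye// leey.
have Ismall (e : R) : 0 < e -> \forall eta \near 0^'+, (I eta <= e%:E)%E.
  move=> e0; have e20 : 0 < e / 2 by rewrite divr_gt0.
  (* Half of the accuracy pays for replacing [Z] by a path [W] of the dense subspace, the other half
     for the smooth approximation of [W]. *)
  have [_ _ /(_ _ e20)[W cW ZW]] := hZ.
  have [r r0 Hr] := smooth_approx hT hbeta levelE hX cW e20.
  have rho_small : \forall eta \near 0^'+, (rho T alpha (Xe eta) X < r%:E)%E.
    have := hrho [set u | (u < r%:E)%E]; apply.
    by apply: open_ereal_lt'; rewrite lte_fin.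
  near=> eta.
  have eta01 : 0 < eta <= 1.
    apply/andP; split; first by near: eta; exact: nbhs_right_gt.
    by near: eta; exact: nbhs_right_le.
  have [|Y [cY sY dY]] := Hr (Xe eta) (hXe _ eta01).
    by apply: ltW; near: eta; exact: rho_small.
  apply: (@le_trans _ _ (cd eta Y)).
    apply: ereal_inf_lbound; exists Y => //; split => //.
    exact: (controlled_closureW hT alpha0 levelE hbeta).
  apply: le_trans (cdist_triangle hT levelE _ _ _ _ W _) _.
  by rewrite [e]splitr EFinD; apply: leeD => //; exact: ltW.
exists Ze; split; first by move=> eta /andP[eta0 _]; have [] := HZe eta eta0.
move=> S /= [e /= e0 HS].
have e20 : 0 < e / 2 by rewrite divr_gt0.
have e40 : 0 < e / 4 by rewrite divr_gt0.
suff: \forall eta \near 0^'+, S (cd eta (Ze eta)) by [].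
have small := Ismall _ e40; near=> eta.
have eta0 : 0 < eta by near: eta; exact: nbhs_right_gt.
have cdle : (cd eta (Ze eta) <= (e / 2)%:E)%E.
  have [_ /le_trans] := HZe eta eta0; apply.
  rewrite [e / 2](_ : _ = e / 4 + e / 4); last lra.
  rewrite EFinD; apply: leeD; first by near: eta; exact: small.
  by rewrite lee_fin; near: eta; exact: nbhs_right_le.
have := cd0 eta (Ze eta); move: cdle.
case: (cd eta (Ze eta)) => [c||]//; rewrite !lee_fin => c1 c2.
by apply: HS; rewrite /ball_/= sub0r normrN ger0_norm//; lra.
Unshelve. all: by end_near. Qed.
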